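(* (1) The set $\mathcal{C}_{\mathbb{I}_1}$ of regular elements of the algebra $\mathbb{I}_1$ satisfies neither the left nor the right Ore condition. Therefore, the left and the right quotient rings of $\mathbb{I}_1$, $\mathcal{C}_{\mathbb{I}_1}^{-1}\mathbb{I}_1$ and $\mathbb{I}_1\mathcal{C}_{\mathbb{I}_1}^{-1}$, do not exist. (2) The set $\mathbb{I}_1^0$ is the largest regular right Ore set in $\mathbb{I}_1$, and so the largest right quotient ring of fractions $\mathrm{Frac}_r(\mathbb{I}_1):=\mathbb{I}_1{\mathbb{I}_1^0}^{-1}=\widetilde{\mathbb{I}}_1$ of $\mathbb{I}_1$ exists. (3) The set $\mathbb{J}_1^0=(\mathbb{I}_1^0)^*$ is the largest regular left Ore set in $\mathbb{I}_1$, and so the largest left quotient ring of fractions $\mathrm{Frac}_l(\mathbb{I}_1):={\mathbb{J}_1^0}^{-1}\mathbb{I}_1=\widetilde{\mathbb{J}}_1$ of $\mathbb{I}_1$ exists. (4) The rings $\mathrm{Frac}_r(\mathbb{I}_1)$ and $\mathrm{Frac}_l(\mathbb{I}_1)$ are not $\mathbb{I}_1$-isomorphic but are $\mathbb{I}_1$-anti-isomorphic. In particular, the largest regular right Ore set in $\mathbb{I}_1$ is not a left Ore set and the largest regular left Ore set in $\mathbb{I}_1$ is not a right Ore set.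
   Context: $K$ is a field of characteristic zero. $\mathbb{I}_1$ is the subalgebra of $\mathrm{End}_K(K[x])$ generated by (multiplication by) $x$, $\partial=\frac{d}{dx}$ and $\int: x^n\mapsto \frac{x^{n+1}}{n+1}$; $H:=\partial x$. The involution $*$ of $\mathbb{I}_1$ is the $K$-algebra anti-automorphism with $\partial^*=\int$, $\int^*=\partial$, $H^*=H$; in (3), $(\mathbb{I}_1^0)^*$ is the image of $\mathbb{I}_1^0$ under $*$. $\mathbb{I}_1^0:=\mathbb{I}_1\cap\mathrm{Aut}_K(K[x])$ is the set of elements of $\mathbb{I}_1$ acting bijectively on $K[x]$; $\widetilde{\mathbb{I}}_1$ is the subalgebra of $\mathrm{End}_K(K[x])$ generated by $\mathbb{I}_1$ and the inverses of the elements of $\mathbb{I}_1^0$. The right $\mathbb{I}_1$-module $K[\partial]\simeq\mathbb{I}_1/\int\mathbb{I}_1$ is faithful, so $\mathbb{I}_1\subseteq\mathrm{End}_K(K[\partial])^{op}$ (linear maps written on the right of their arguments) via $a\mapsto(p\mapsto pa)$; $\mathbb{J}_1^0$ is the set of elements of $\mathbb{I}_1$ acting bijectively on $K[\partial]$, and $\widetilde{\mathbb{J}}_1$ is the subalgebra of $\mathrm{End}_K(K[\partial])^{op}$ generated by $\mathbb{I}_1$ and the inverses of the elements of $\mathbb{J}_1^0$. For a ring $R$, an element is regular if it is neither a left nor a right zero divisor; $\mathcal{C}_R$ is the set of regular elements. A multiplicatively closed set $S\subseteq R$ is a right (resp. left) Ore set, i.e. satisfies the right (resp. left) Ore condition,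 if $rS\cap sR\ne\emptyset$ (resp. $Sr\cap Rs\ne\emptyset$) for all $r\in R$, $s\in S$. A maximal regular right Ore set is a right Ore set consisting of regular elements, maximal with respect to inclusion among such sets; if it is unique it is called the largest regular right Ore set $S$, and $\mathrm{Frac}_r(R):=RS^{-1}$ is the largest right quotient ring of $R$; similarly on the left with $\mathrm{Frac}_l(R)$. The right (left) quotient ring of $R$ is the right (left) localization of $R$ at $\mathcal{C}_R$. If rings $S,T$ contain $R$ as a subring, they are $R$-isomorphic if there is a ring isomorphism $\varphi:S\to T$ with $\varphi(r)=r$ for all $r\in R$, and $R$-anti-isomorphic if there is a ring anti-isomorphism $\varphi:S\to T$ with $\varphi(R)=R$. *)

(* Defs.v *)
From HB Require Import structures.
From mathcomp Require Import all_boot all_algebra.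
From mathcomp Require Import boolp classical_sets.

Set Implicit Arguments.
Unset Strict Implicit.
Unset Printing Implicit Defensive.

Import GRing.Theory.
Local Open Scope classical_set_scope.
Local Open Scope ring_scope.

Section Localization.
Variable R : pzRingType.
Implicit Types S : set R.

Definition regular (a : R) : Prop :=
  (forall b, a * b = 0 -> b = 0) /\ (forall b, b * a = 0 -> b = 0).

Definition regular_elements : set R := [set a | regular a].

Definition mult_closed S : Prop :=
  S 1 /\ (forall s t, S s -> S t -> S (s * t)).

Definition right_Ore_condition S : Prop :=
  forall r s, S s -> exists t u, S t /\ r * t = s * u.

Definition left_Ore_condition S : Prop :=
  forall r s, S s -> exists t u, S t /\ t * r = u * s.

Definition right_Ore_set S : Prop := mult_closed S /\ right_Ore_condition S.
Definition left_Ore_set S : Prop := mult_closed S /\ left_Ore_condition S.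

Definition regular_right_Ore_set S : Prop :=
  right_Ore_set S /\ S `<=` regular_elements.
Definition regular_left_Ore_set S : Prop :=
  left_Ore_set S /\ S `<=` regular_elements.

Definition maximal_regular_right_Ore_set S : Prop :=
  regular_right_Ore_set S /\
  forall T, regular_right_Ore_set T -> S `<=` T -> T = S.
Definition maximal_regular_left_Ore_set S : Prop :=
  regular_left_Ore_set S /\
  forall T, regular_left_Ore_set T -> S `<=` T -> T = S.

Definition largest_regular_right_Ore_set S : Prop :=
  maximal_regular_right_Ore_set S /\
  forall T, maximal_regular_right_Ore_set T -> T = S.
Definition largest_regular_left_Ore_set S : Prop :=
  maximal_regular_left_Ore_set S /\
  forall T, maximal_regular_left_Ore_set T -> T = S.

Definition inverse_of (Q : pzRingType) (u v : Q) : Prop :=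
  u * v = 1 /\ v * u = 1.

(* The ring Q, with the structure map f, is the right localization R S^{-1}:
   S becomes invertible, all elements are right fractions f r * (f s)^{-1},
   and the kernel is as small as possible. *)
Definition right_localization S (Q : pzRingType) (f : {rmorphism R -> Q})
    : Prop :=
  [/\ forall s, S s -> exists u, inverse_of u (f s),
      forall q, exists r s u, [/\ S s, inverse_of u (f s) & q = f r * u] &
      forall r, f r = 0 <-> exists2 s, S s & r * s = 0].

Definition left_localization S (Q : pzRingType) (f : {rmorphism R -> Q})
    : Prop :=
  [/\ forall s, S s -> exists u, inverse_of u (f s),
      forall q, exists r s u, [/\ S s, inverse_of u (f s) & q = u * f r] &
      forall r, f r = 0 <-> exists2 s, S s & s * r = 0].

Definition right_quotient_ring (Q : pzRingType) (f : {rmorphism R -> Q}) :=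
  right_localization regular_elements f.
Definition left_quotient_ring (Q : pzRingType) (f : {rmorphism R -> Q}) :=
  left_localization regular_elements f.

Definition is_Frac_r (Q : pzRingType) (f : {rmorphism R -> Q}) : Prop :=
  exists2 S, largest_regular_right_Ore_set S & right_localization S f.
Definition is_Frac_l (Q : pzRingType) (f : {rmorphism R -> Q}) : Prop :=
  exists2 S, largest_regular_left_Ore_set S & left_localization S f.

Definition R_isomorphic (Q1 Q2 : pzRingType)
    (f1 : {rmorphism R -> Q1}) (f2 : {rmorphism R -> Q2}) : Prop :=
  exists phi : {rmorphism Q1 -> Q2},
    bijective phi /\ forall r, phi (f1 r) = f2 r.

Definition R_anti_isomorphic (Q1 Q2 : pzRingType)
    (f1 : {rmorphism R -> Q1}) (f2 : {rmorphism R -> Q2}) : Prop :=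
  exists phi : {rmorphism Q1 -> Q2^c},
    bijective phi /\ phi @` range f1 = range f2.

End Localization.

(* The converse of an algebra is an algebra. *)
HB.instance Definition _ (K : comNzRingType) (A : algType K) :=
  GRing.LSemiModule.copy (A^c) A.
HB.instance Definition _ (K : comNzRingType) (A : algType K) :=
  GRing.LSemiModule_isLSemiAlgebra.Build K (A^c)
    (fun k (u v : A^c) => scalerAr k (v : A) (u : A)).
HB.instance Definition _ (K : comNzRingType) (A : algType K) :=
  GRing.LSemiAlgebra_isSemiAlgebra.Build K (A^c)
    (fun k (u v : A^c) => scalerAl k (v : A) (u : A)).

Section GeneratedSubalgebra.
Variables (K : comNzRingType) (A : algType K).

Definition gen_alg (G : set A) : {pred A} := fun a =>
  `[< forall B : {pred A}, GRing.subalg_closed B ->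
        (forall g, G g -> g \in B) -> a \in B >].

Lemma gen_algP (G : set A) (a : A) :
  reflect (forall B : {pred A}, GRing.subalg_closed B ->
             (forall g, G g -> g \in B) -> a \in B) (a \in gen_alg G).
Proof. exact: asboolP. Qed.

Lemma mem_gen_alg (G : set A) (a : A) : G a -> a \in gen_alg G.
Proof. by move=> Ga; apply/gen_algP => B _; apply. Qed.

Lemma gen_alg_closed (G : set A) : GRing.subalg_closed (gen_alg G).
Proof.
split=> [|k u v|u v].
- by apply/gen_algP => B [].
- move=> /gen_algP Hu /gen_algP Hv; apply/gen_algP => B BA BG.
  by case: (BA) => _ + _; apply; [apply: Hu|apply: Hv].
- move=> /gen_algP Hu /gen_algP Hv; apply/gen_algP => B BA BG.
  by case: (BA) => _ _; apply; [apply: Hu|apply: Hv].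
Qed.

HB.instance Definition _ (G : set A) :=
  GRing.isSubalgClosed.Build K A (gen_alg G) (gen_alg_closed G).

Record subalg (G : set A) :=
  Subalg { subalg_val : A; subalg_valP : subalg_val \in gen_alg G }.

HB.instance Definition _ G := [isSub for @subalg_val G].
HB.instance Definition _ G := [Choice of subalg G by <:].
HB.instance Definition _ G := [SubChoice_isSubAlgebra of subalg G by <:].

Lemma subalg_ind_closed (G : set A) (P : subalg G -> Prop) :
  P 1 -> (forall k u v, P u -> P v -> P (k *: u + v)) ->
  (forall u v, P u -> P v -> P (u * v)) ->
  (forall u, G (val u) -> P u) -> forall u, P u.
Proof.
move=> P1 PL PM PG u.
have : val u \in gen_alg G := valP u.
move/gen_algP.
pose B : {pred A} := fun a => `[< exists2 b, P b & val b = a >].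
have BP a : reflect (exists2 b, P b & val b = a) (a \in B) by exact: asboolP.
have BA : GRing.subalg_closed B.
  split=> [|k _ _ /BP[a Pa <-] /BP[b Pb <-]|_ _ /BP[a Pa <-] /BP[b Pb <-]].
  - by apply/BP; exists 1; rewrite ?rmorph1.
  - by apply/BP; exists (k *: a + b); [exact: PL|rewrite linearP].
  - by apply/BP; exists (a * b); [exact: PM|rewrite rmorphM].
move=> /(_ B BA) uB; suff /BP[v Pv /val_inj <-] : val u \in B by [].
apply: uB => g Gg; apply/BP; exists (Subalg (mem_gen_alg Gg)) => //.
exact: PG.
Qed.

End GeneratedSubalgebra.

Section EndPoly.
Variable K : fieldType.

Record endpoly :=
  Endpoly { endpoly_fun :> {poly K} -> {poly K}; endpolyP : linear endpoly_fun }.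

Implicit Types f g h : endpoly.

HB.instance Definition _ f :=
  GRing.isLinear.Build K {poly K} {poly K} _ (endpoly_fun f) (@endpolyP f).

Lemma endpoly_eq f g : endpoly_fun f =1 endpoly_fun g -> f = g.
Proof.
case: f g => [f Hf] [g Hg] /= /funext fg; case: g / fg Hg => Hg.
by rewrite (Prop_irrelevance Hf Hg).
Qed.

HB.instance Definition _ := gen_eqMixin endpoly.
HB.instance Definition _ := gen_choiceMixin endpoly.

Local Lemma endpoly_zero_lin_subproof : linear (fun _ : {poly K} => 0 : {poly K}).
Proof. by move=> k p q; rewrite scaler0 addr0. Qed.
Local Lemma endpoly_opp_lin_subproof f : linear (fun p => - f p).
Proof. by move=> k p q; rewrite linearP opprD scalerN. Qed.
Local Lemma endpoly_add_lin_subproof f g : linear (fun p => f p + g p).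
Proof. by move=> k p q; rewrite !linearP scalerDr addrACA. Qed.
Local Lemma endpoly_id_lin_subproof : linear (fun p : {poly K} => p).
Proof. by []. Qed.
Local Lemma endpoly_comp_lin_subproof f g : linear (fun p => f (g p)).
Proof. by move=> k p q; rewrite !linearP. Qed.
Local Lemma endpoly_scale_lin_subproof (c : K) f : linear (fun p => c *: f p).
Proof. by move=> k p q; rewrite linearP scalerDr !scalerA mulrC. Qed.

Definition endpoly0 := Endpoly endpoly_zero_lin_subproof.
Definition endpoly_opp f := Endpoly (endpoly_opp_lin_subproof f).
Definition endpoly_add f g := Endpoly (endpoly_add_lin_subproof f g).
Definition endpoly1 := Endpoly endpoly_id_lin_subproof.
Definition endpoly_mul f g := Endpoly (endpoly_comp_lin_subproof f g).
Definition endpoly_scale c f := Endpoly (endpoly_scale_lin_subproof c f).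

Local Lemma endpoly_addA_subproof : associative endpoly_add.
Proof. by move=> f g h; apply: endpoly_eq => p /=; rewrite addrA. Qed.
Local Lemma endpoly_addC_subproof : commutative endpoly_add.
Proof. by move=> f g; apply: endpoly_eq => p /=; rewrite addrC. Qed.
Local Lemma endpoly_add0_subproof : left_id endpoly0 endpoly_add.
Proof. by move=> f; apply: endpoly_eq => p /=; rewrite add0r. Qed.
Local Lemma endpoly_addN_subproof : left_inverse endpoly0 endpoly_opp endpoly_add.
Proof. by move=> f; apply: endpoly_eq => p /=; rewrite addNr. Qed.
HB.instance Definition _ := GRing.isZmodule.Build endpoly
  endpoly_addA_subproof endpoly_addC_subproof
  endpoly_add0_subproof endpoly_addN_subproof.

Local Lemma endpoly_mulA_subproof : associative endpoly_mul.
Proof. by move=> f g h; apply: endpoly_eq. Qed.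
Local Lemma endpoly_mul1_subproof : left_id endpoly1 endpoly_mul.
Proof. by move=> f; apply: endpoly_eq. Qed.
Local Lemma endpoly_mulr1_subproof : right_id endpoly1 endpoly_mul.
Proof. by move=> f; apply: endpoly_eq. Qed.
Local Lemma endpoly_mulDl_subproof : left_distributive endpoly_mul endpoly_add.
Proof. by move=> f g h; apply: endpoly_eq. Qed.
Local Lemma endpoly_mulDr_subproof : right_distributive endpoly_mul endpoly_add.
Proof. by move=> f g h; apply: endpoly_eq => p /=; rewrite linearD. Qed.
Local Lemma endpoly_one_neq0_subproof : endpoly1 != endpoly0.
Proof.
by apply/eqP => /(congr1 (fun f : endpoly => f 1)) /= /eqP; rewrite oner_eq0.
Qed.
HB.instance Definition _ := GRing.Zmodule_isNzRing.Build endpoly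
  endpoly_mulA_subproof endpoly_mul1_subproof endpoly_mulr1_subproof
  endpoly_mulDl_subproof endpoly_mulDr_subproof endpoly_one_neq0_subproof.

Local Lemma endpoly_scaleA_subproof a b f : endpoly_scale a (endpoly_scale b f) = endpoly_scale (a * b) f.
Proof. by apply: endpoly_eq => p /=; rewrite scalerA. Qed.
Local Lemma endpoly_scale1_subproof : left_id 1 endpoly_scale.
Proof. by move=> f; apply: endpoly_eq => p /=; rewrite scale1r. Qed.
Local Lemma endpoly_scaleDr_subproof : right_distributive endpoly_scale +%R.
Proof. by move=> c f g; apply: endpoly_eq => p /=; rewrite scalerDr. Qed.
Local Lemma endpoly_scaleDl_subproof f : {morph endpoly_scale^~ f : a b / a + b}.
Proof. by move=> a b; apply: endpoly_eq => p /=; rewrite scalerDl. Qed.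
HB.instance Definition _ := GRing.Zmodule_isLmodule.Build K endpoly
  endpoly_scaleA_subproof endpoly_scale1_subproof
  endpoly_scaleDr_subproof endpoly_scaleDl_subproof.

Local Lemma endpoly_scaleAl_subproof (a : K) f g : a *: (f * g) = (a *: f) * g.
Proof. exact: endpoly_eq. Qed.
HB.instance Definition _ := GRing.Lmodule_isLalgebra.Build K endpoly
  endpoly_scaleAl_subproof.
Local Lemma endpoly_scaleAr_subproof (a : K) f g : a *: (f * g) = f * (a *: g).
Proof. by apply: endpoly_eq => p /=; rewrite linearZ. Qed.
HB.instance Definition _ := GRing.Lalgebra_isAlgebra.Build K endpoly
  endpoly_scaleAr_subproof.

Lemma endpoly_mulE f g p : (f * g) p = f (g p). Proof. by []. Qed.
Lemma endpoly_addE f g p : (f + g) p = f p + g p. Proof. by []. Qed.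
Lemma endpoly_scaleE c f p : (c *: f) p = c *: f p. Proof. by []. Qed.
Lemma endpoly_1E p : (1 : endpoly) p = p. Proof. by []. Qed.

Definition poly_int (p : {poly K}) : {poly K} :=
  'X * \poly_(i < size p) (p`_i / i.+1%:R).

Lemma coef_poly_int p i :
  (poly_int p)`_i = if i is j.+1 then p`_j / i%:R else 0.
Proof.
rewrite /poly_int coefXM; case: i => //= i; rewrite coef_poly.
by case: ltnP => // /leq_sizeP/(_ i (leqnn i)) ->; rewrite mul0r.
Qed.

Local Lemma endpoly_mulX_lin_subproof : linear (fun p : {poly K} => 'X * p).
Proof. by move=> k p q; rewrite mulrDr scalerAr. Qed.
Local Lemma endpoly_int_lin_subproof : linear poly_int.
Proof.
move=> k p q; apply/polyP => i; rewrite coefD coefZ !coef_poly_int.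
by case: i => [|i]; rewrite ?mulr0 ?addr0 // coefD coefZ mulrDl mulrA.
Qed.

Definition x_op : endpoly := Endpoly endpoly_mulX_lin_subproof.
Definition d_op : endpoly := Endpoly (linearP (@deriv K)).
Definition int_op : endpoly := Endpoly endpoly_int_lin_subproof.

Definition I1_gens : set endpoly := [set x_op; d_op; int_op].
Definition I1 := subalg I1_gens.
HB.instance Definition _ := GRing.Algebra.on I1.

Fact I1_x_subproof : x_op \in gen_alg I1_gens.
Proof. by apply: mem_gen_alg; left; left. Qed.
Fact I1_d_subproof : d_op \in gen_alg I1_gens.
Proof. by apply: mem_gen_alg; left; right. Qed.
Fact I1_int_subproof : int_op \in gen_alg I1_gens.
Proof. by apply: mem_gen_alg; right. Qed.

Definition I1_x : I1 := Subalg I1_x_subproof.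
Definition I1_d : I1 := Subalg I1_d_subproof.
Definition I1_int : I1 := Subalg I1_int_subproof.
Definition I1_H : I1 := I1_d * I1_x.

Lemma I1_ind (P : I1 -> Prop) :
  P 1 -> (forall k u v, P u -> P v -> P (k *: u + v)) ->
  (forall u v, P u -> P v -> P (u * v)) ->
  P I1_x -> P I1_d -> P I1_int -> forall u, P u.
Proof.
move=> P1 PL PM Px Pd Pi; apply: subalg_ind_closed => // u [[]|] /= E.
- by rewrite (_ : u = I1_x) //; apply: val_inj.
- by rewrite (_ : u = I1_d) //; apply: val_inj.
- by rewrite (_ : u = I1_int) //; apply: val_inj.
Qed.

Lemma I1_valZ k (a : I1) : val (k *: a) = k *: (val a : endpoly).
Proof. exact: linearZ. Qed.

Lemma I1_valD (a b : I1) : val (a + b) = (val a : endpoly) + val b.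
Proof. exact: rmorphD. Qed.
Lemma I1_valM (a b : I1) : val (a * b) = (val a : endpoly) * val b.
Proof. exact: rmorphM. Qed.
Lemma I1_val1 : val (1 : I1) = 1 :> endpoly.
Proof. exact: rmorph1. Qed.

Definition I1_0 : set I1 := [set a | bijective (val a : endpoly)].

Definition It_gens : set endpoly :=
  [set b | (exists a : I1, b = val a) \/
           (exists2 a : I1, I1_0 a & inverse_of b (val a))].
Definition It := subalg It_gens.
HB.instance Definition _ := GRing.Algebra.on It.

Fact I1_It_subproof (a : I1) : val a \in gen_alg It_gens.
Proof. by apply: mem_gen_alg; left; exists a. Qed.
Definition I1_It (a : I1) : It := Subalg (I1_It_subproof a).
Fact I1_It_zmod : zmod_morphism I1_It.
Proof. by move=> a b; apply: val_inj; rewrite [RHS]rmorphB; exact: rmorphB. Qed.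
Fact I1_It_monoid : monoid_morphism I1_It.
Proof.
split=> [|a b]; apply: val_inj; first by rewrite [RHS]rmorph1; exact: rmorph1.
by rewrite [RHS]rmorphM; exact: rmorphM.
Qed.
HB.instance Definition _ := GRing.isZmodMorphism.Build I1 It I1_It I1_It_zmod.
HB.instance Definition _ :=
  GRing.isMonoidMorphism.Build I1 It I1_It I1_It_monoid.

End EndPoly.

Section RightModule.
Variable K : fieldType.
Hypothesis charK : [pchar K] =i pred0.

Local Lemma natS_neq0 n : (n.+1)%:R != 0 :> K.
Proof. by have /(_ n.+1) := (pcharf0P K).1 charK => ->. Qed.

Local Lemma fact_neq0 n : (n`!)%:R != 0 :> K.
Proof. by have /(_ n`!) := (pcharf0P K).1 charK => ->; rewrite -lt0n fact_gt0. Qed.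

Lemma I1_d_int : I1_d K * I1_int K = 1.
Proof.
apply: val_inj; apply: endpoly_eq => p.
rewrite I1_valM I1_val1 endpoly_mulE endpoly_1E /=.
apply/polyP => i; rewrite coef_deriv coef_poly_int.
by rewrite -[LHS]mulr_natr (divfK (natS_neq0 _)).
Qed.

(* Elements of K[\partial] are written as polynomials p : {poly K}; this is
   the element p(\partial) of I_1. *)
Definition at_d (p : {poly K}) : I1 K := horner_alg (I1_d K) p.

Lemma at_dP k p q : at_d (k *: p + q) = k *: at_d p + at_d q.
Proof. by rewrite /at_d linearP /= mulr_algl. Qed.
Lemma at_dD p q : at_d (p + q) = at_d p + at_d q.
Proof. exact: rmorphD. Qed.
Lemma at_dB p q : at_d (p - q) = at_d p - at_d q.
Proof. exact: rmorphB. Qed.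
Lemma at_d0 : at_d 0 = 0. Proof. exact: rmorph0. Qed.
Lemma at_dX p : at_d (p * 'X) = at_d p * I1_d K.
Proof. by rewrite /at_d rmorphM /= horner_algX. Qed.
Lemma at_dC c : at_d c%:P = c%:A.
Proof. exact: horner_algC. Qed.

(* q = p a in the right I_1-module K[\partial], identified with I_1 / \int I_1
   through the classes of the elements of K[\partial]. *)
Definition Kd_rel (a : I1 K) (p q : {poly K}) : Prop :=
  exists b : I1 K, at_d p * a - at_d q = I1_int K * b.

Lemma at_d_coef0 q n :
  ((val (at_d q) : endpoly K) 'X^n)`_0 = q`_n * (n`!)%:R.
Proof.
elim/poly_ind: q n => [|q c IH] n.
  by rewrite at_d0 coef0 mul0r rmorph0 coef0.
rewrite at_dD at_dX at_dC I1_valD I1_valM I1_valZ I1_val1.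
rewrite endpoly_addE endpoly_mulE endpoly_scaleE endpoly_1E /=.
rewrite derivXn coefD coefZ coefXn coefD coefMX coefC.
case: n => [|n] /=.
  by rewrite mulr0n linear0 coef0 fact0 !add0r.
by rewrite linearMn /= coefMn IH mulr0 !addr0 factS natrM mulr_natr
  [_.+1%:R * _]mulrC mulrA !mulr_natr.
Qed.

Lemma at_d_int0 q b : at_d q = I1_int K * b -> q = 0.
Proof.
move=> E; apply/polyP => n; have := at_d_coef0 q n.
rewrite E I1_valM endpoly_mulE /= coef_poly_int coef0 => /esym/eqP.
by rewrite mulf_eq0 (negPf (fact_neq0 n)) orbF => /eqP.
Qed.

Lemma Kd_rel_uniq a p q q' : Kd_rel a p q -> Kd_rel a p q' -> q = q'.
Proof.
move=> [b Eb] [b' Eb']; apply/eqP; rewrite -subr_eq0; apply/eqP.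
apply: (@at_d_int0 _ (b' - b)); rewrite mulrBr -Eb -Eb' at_dB.
by rewrite opprB [RHS]addrC addrA subrK.
Qed.

Lemma Kd_rel1 p : Kd_rel 1 p p.
Proof. by exists 0; rewrite mulr1 subrr mulr0. Qed.

Lemma Kd_relP k a b p q r :
  Kd_rel a p q -> Kd_rel b p r -> Kd_rel (k *: a + b) p (k *: q + r).
Proof.
move=> [c Ec] [c' Ec']; exists (k *: c + c').
by rewrite at_dP !mulrDr -!scalerAr opprD addrACA -Ec -Ec' scalerBr.
Qed.

Lemma Kd_rel_lin k a p p' q q' :
  Kd_rel a p q -> Kd_rel a p' q' -> Kd_rel a (k *: p + p') (k *: q + q').
Proof.
move=> [c Ec] [c' Ec']; exists (k *: c + c').
by rewrite !at_dP mulrDl mulrDr -scalerAl -scalerAr opprD addrACA -Ec -Ec'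
  scalerBr.
Qed.

Lemma Kd_relM a b p q r : Kd_rel a p q -> Kd_rel b q r -> Kd_rel (a * b) p r.
Proof.
move=> [c Ec] [c' Ec']; exists (c * b + c').
by rewrite mulrDr !mulrA -Ec -Ec' mulrBl addrA subrK.
Qed.

Lemma at_d_x p : at_d p * I1_x K = I1_x K * at_d p + at_d p^`().
Proof.
have dx : I1_d K * I1_x K = I1_x K * I1_d K + 1.
  apply: val_inj; apply: endpoly_eq => q.
  rewrite I1_valD !I1_valM I1_val1 endpoly_addE !endpoly_mulE /=.
  by rewrite derivM derivX mul1r addrC.
elim/poly_ind: p => [|p c IH]; first by rewrite deriv0 at_d0 mulr0 mul0r addr0.
rewrite derivD derivC addr0 derivM derivX mulr1 !at_dD !at_dX at_dC.
rewrite mulrDl -mulrA dx mulrDr mulr1 mulrA IH mulrDl mulrDr.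
rewrite -scalerAl -scalerAr mul1r mulr1 !mulrA.
by rewrite [RHS]addrAC !addrA.
Qed.

Lemma Kd_rel_ex a p : exists q, Kd_rel a p q.
Proof.
elim/I1_ind: a p => [p|k u v Hu Hv p|u v Hu Hv p|p|p|p].
- by exists p; exact: Kd_rel1.
- have [[q Hq] [r Hr]] := (Hu p, Hv p).
  by exists (k *: q + r); exact: Kd_relP.
- have [q Hq] := Hu p; have [r Hr] := Hv q.
  by exists r; exact: Kd_relM Hq Hr.
- exists p^`(); exists (I1_H K * at_d p).
  have -> : I1_int K * (I1_H K * at_d p) = I1_x K * at_d p.
    rewrite mulrA; congr (_ * _); apply: val_inj; apply: endpoly_eq => q.
    rewrite !I1_valM !endpoly_mulE /=; apply/polyP => i.
    rewrite coef_poly_int [RHS]coefXM; case: i => //= i.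
    by rewrite coef_deriv coefXM /= -[q`_i *+ _]mulr_natr (mulfK (natS_neq0 _)).
  by rewrite at_d_x addrK.
- exists (p * 'X); exists 0.
  by rewrite mulr0 at_dX subrr.
- elim/poly_ind: p => [|p c _].
    by exists 0; exists 0; rewrite at_d0 mul0r mulr0 subrr.
  exists p; exists c%:A.
  by rewrite at_dD at_dX at_dC mulrDl -mulrA I1_d_int mulr1 addrAC subrr add0r
    -scalerAl -scalerAr mul1r mulr1.
Qed.

Definition Kd_fun (a : I1 K) (p : {poly K}) : {poly K} :=
  projT1 (cid (Kd_rel_ex a p)).

Lemma Kd_funP a p : Kd_rel a p (Kd_fun a p).
Proof. exact: projT2 (cid (Kd_rel_ex a p)). Qed.

Lemma Kd_funE a p q : Kd_rel a p q -> Kd_fun a p = q.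
Proof. exact/Kd_rel_uniq/Kd_funP. Qed.

Fact Kd_fun_linear a : linear (Kd_fun a).
Proof.
by move=> k p q; apply/Kd_funE/Kd_rel_lin; exact: Kd_funP.
Qed.

(* The embedding of I_1 into End_K(K[\partial])^op. *)
Definition Kd_act (a : I1 K) : (endpoly K)^c := Endpoly (Kd_fun_linear a).

Fact Kd_act_linear : linear Kd_act.
Proof.
move=> k a b; apply: endpoly_eq => p.
by apply/Kd_funE/Kd_relP; exact: Kd_funP.
Qed.
Fact Kd_act_monoid : monoid_morphism Kd_act.
Proof.
split=> [|a b]; apply: endpoly_eq => p; first by apply/Kd_funE/Kd_rel1.
by apply: Kd_funE; apply: Kd_relM (Kd_funP a p) (Kd_funP b _).
Qed.
HB.instance Definition _ :=
  GRing.isLinear.Build K (I1 K) (endpoly K)^c _ Kd_act Kd_act_linear.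
HB.instance Definition _ :=
  GRing.isMonoidMorphism.Build (I1 K) (endpoly K)^c Kd_act Kd_act_monoid.

Definition J1_0 : set (I1 K) := [set a | bijective (Kd_act a : endpoly K)].

Definition Jt_gens : set (endpoly K)^c :=
  [set b | (exists a : I1 K, b = Kd_act a) \/
           (exists2 a : I1 K, J1_0 a & inverse_of b (Kd_act a))].
Definition Jt := subalg Jt_gens.
HB.instance Definition _ := GRing.Algebra.on Jt.

Fact I1_Jt_subproof (a : I1 K) : Kd_act a \in gen_alg Jt_gens.
Proof. by apply: mem_gen_alg; left; exists a. Qed.
Definition I1_Jt (a : I1 K) : Jt := Subalg (I1_Jt_subproof a).
Fact I1_Jt_zmod : zmod_morphism I1_Jt.
Proof. by move=> a b; apply: val_inj; rewrite [RHS]rmorphB; exact: rmorphB. Qed.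
Fact I1_Jt_monoid : monoid_morphism I1_Jt.
Proof.
split=> [|a b]; apply: val_inj; first by rewrite [RHS]rmorph1; exact: rmorph1.
by rewrite [RHS]rmorphM; exact: rmorphM.
Qed.
HB.instance Definition _ := GRing.isZmodMorphism.Build (I1 K) Jt I1_Jt I1_Jt_zmod.
HB.instance Definition _ :=
  GRing.isMonoidMorphism.Build (I1 K) Jt I1_Jt I1_Jt_monoid.

Definition is_I1_star (s : I1 K -> I1 K) : Prop :=
  [/\ linear s, s 1 = 1, forall a b, s (a * b) = s b * s a, bijective s &
      [/\ s (I1_d K) = I1_int K, s (I1_int K) = I1_d K & s (I1_H K) = I1_H K]].

(* The involution is realized as the transpose for the bilinear form in which
   the monomials x^i / i! are orthonormal. *)
Local Definition bil (p q : {poly K}) : K :=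
  \sum_(i < size p) p`_i * q`_i * (i`!)%:R ^+ 2.

Local Lemma bilE n (p q : {poly K}) : (size p <= n)%N ->
  bil p q = \sum_(i < n) p`_i * q`_i * (i`!)%:R ^+ 2.
Proof.
move=> pn; rewrite /bil.
rewrite (big_ord_widen n (fun i => p`_i * q`_i * (i`!)%:R ^+ 2) pn) big_mkcond.
apply: eq_bigr => i _; case: ltnP => // /leq_sizeP/(_ i (leqnn i)) ->.
by rewrite !mul0r.
Qed.

Local Lemma bilC (p q : {poly K}) : bil p q = bil q p.
Proof.
rewrite (@bilE (maxn (size p) (size q))) ?leq_maxl //.
rewrite (@bilE (maxn (size p) (size q)) q) ?leq_maxr //.
by apply: eq_bigr => i _; rewrite [p`_i * _]mulrC.
Qed.

Local Lemma bilPr k (p q r : {poly K}) : bil p (k *: q + r) = k * bil p q + bil p r.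
Proof.
rewrite /bil mulr_sumr -big_split /=; apply: eq_bigr => i _.
rewrite coefD coefZ mulrDr mulrDl; congr (_ + _); by rewrite !mulrA [p`_i * k]mulrC.
Qed.

Local Lemma bil_inj (q q' : {poly K}) : (forall p, bil p q = bil p q') -> q = q'.
Proof.
move=> E; apply/polyP => n; have := E 'X^n.
rewrite /bil size_polyXn !big_ord_recr /= !coefXn eqxx !mul1r.
rewrite !big1; last 2 first.
- by move=> i _; rewrite coefXn ltn_eqF ?ltn_ord // !mul0r.
- by move=> i _; rewrite coefXn ltn_eqF ?ltn_ord // !mul0r.
rewrite !add0r => /mulIf; apply.
by rewrite expf_neq0 // fact_neq0.
Qed.

Local Definition adj (a b : I1 K) : Prop := forall p q,
  bil ((val a : endpoly K) p) q = bil p ((val b : endpoly K) q).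

Local Lemma adj_sym a b : adj a b -> adj b a.
Proof. by move=> ab p q; rewrite bilC -ab bilC. Qed.

Local Lemma adj_uniq a b b' : adj a b -> adj a b' -> b = b'.
Proof.
move=> ab ab'; apply: val_inj; apply: endpoly_eq => q.
by apply: bil_inj => p; rewrite -ab.
Qed.

Local Lemma adj1 : adj 1 1. Proof. by move=> p q; rewrite I1_val1. Qed.

Local Lemma adjP k a b a' b' : adj a b -> adj a' b' -> adj (k *: a + a') (k *: b + b').
Proof.
move=> ab ab' p q; rewrite !I1_valD !I1_valZ !endpoly_addE !endpoly_scaleE.
by rewrite bilPr -ab -ab' bilC bilPr bilC; congr (_ * _ + _); rewrite bilC.
Qed.

Local Lemma adjM a b a' b' : adj a b -> adj a' b' -> adj (a * a') (b' * b).
Proof.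
by move=> ab ab' p q; rewrite !I1_valM !endpoly_mulE ab ab'.
Qed.

Local Lemma adj_d_int : adj (I1_d K) (I1_int K).
Proof.
move=> p q /=; rewrite (@bilE (size p)); last first.
  by have [->|p0] := eqVneq p 0; [rewrite deriv0 size_poly0|exact/ltnW/lt_size_deriv].
rewrite (@bilE (size p).+1) // big_ord_recl /= coef_poly_int mulr0 mul0r add0r.
apply: eq_bigr => i _; rewrite /bump /= add1n coef_deriv coef_poly_int.
rewrite factS natrM exprMn -[p`_i.+1 *+ _]mulr_natr [i.+1%:R ^+ 2]expr2 -!mulrA.
by rewrite (mulKf (natS_neq0 _)) [i.+1%:R * (q`_i * _)]mulrCA.
Qed.

Local Lemma adj_H : adj (I1_H K) (I1_H K).
Proof.
move=> p q; have HE r i : ((val (I1_H K) : endpoly K) r)`_i = r`_i *+ i.+1.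
  by rewrite I1_valM endpoly_mulE /= coef_deriv coefXM.
rewrite (@bilE (size p)); last first.
  by apply/leq_sizeP => i pi; rewrite HE nth_default // mul0rn.
apply: eq_bigr => i _; rewrite !HE.
by rewrite mulrnAl mulrnAr.
Qed.

Lemma I1_x_int_H : I1_x K = I1_int K * I1_H K.
Proof.
apply: val_inj; apply: endpoly_eq => q.
rewrite !I1_valM !endpoly_mulE /=; apply/polyP => i.
rewrite coef_poly_int [LHS]coefXM; case: i => //= i.
by rewrite coef_deriv coefXM /= -[q`_i *+ _]mulr_natr (mulfK (natS_neq0 _)).
Qed.

Local Lemma adj_ex a : exists b, adj a b.
Proof.
elim/I1_ind: a => [|k u v [u' Hu] [v' Hv]|u v [u' Hu] [v' Hv]|||].
- by exists 1; exact: adj1.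
- by exists (k *: u' + v'); exact: adjP.
- by exists (v' * u'); exact: adjM.
- rewrite I1_x_int_H; exists (I1_H K * I1_d K).
  exact: adjM (adj_sym adj_d_int) adj_H.
- by exists (I1_int K); exact: adj_d_int.
- by exists (I1_d K); exact: adj_sym adj_d_int.
Qed.

Lemma I1_star_ex : exists s, is_I1_star s.
Proof.
have /choice[s sP] : forall a, exists b, adj a b by exact: adj_ex.
have sE a b : adj a b -> s a = b by exact/adj_uniq.
exists s; split=> [k a b||a b||].
- by apply/sE/adjP.
- exact/sE/adj1.
- by apply/sE/adjM.
- by exists s => a; apply/sE/adj_sym.
- split; apply: sE; [exact: adj_d_int|exact: adj_sym adj_d_int|exact: adj_H].
Qed.

Lemma I1_star_uniq s s' : is_I1_star s -> is_I1_star s' -> s =1 s'.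
Proof.
move=> [sL s1 sM _ [sd si sH]] [sL' s1' sM' _ [sd' si' sH']].
elim/I1_ind => [|k u v Hu Hv|u v Hu Hv|||].
- by rewrite s1.
- by rewrite sL sL' Hu Hv.
- by rewrite sM sM' Hu Hv.
- by rewrite I1_x_int_H sM sM' sH si sH' si'.
- by rewrite sd.
- by rewrite si.
Qed.

Definition I1_star : I1 K -> I1 K := projT1 (cid I1_star_ex).

Lemma I1_starP : is_I1_star I1_star.
Proof. exact: projT2 (cid I1_star_ex). Qed.

End RightModule.

(* Main.v *)
Require Import Defs.
From HB Require Import structures.
From mathcomp Require Import all_boot all_algebra.
From mathcomp Require Import boolp classical_sets.
From mathcomp Require Import zify.

Import GRing.Theory.
Local Open Scope classical_set_scope.
Local Open Scope ring_scope.

(** Everything is read off the action of I_1 on K[x].  Two facts carry the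
proof.

Every endomorphism of finite support, that is, one killing x^n K[x] for some
n, lies in I_1 ([finite_support_I1]).  In particular I_1 contains all maps
p |-> p(0) v.  If S is a right Ore set of regular elements and s is in S, then
the Ore condition for s and such a map shows that every v is in the image of
s, and left regularity shows that s is injective: S is contained in I_1^0
([regular_right_Ore_I1_0]).  So I_1^0 is the largest regular right Ore set as
soon as it is one.

The right Ore condition for I_1^0 asks, given a in I_1 and b in I_1^0, for a
bijective T such that b^-1 a T lies in I_1.  Endomorphisms of finite support
are harmless: b^-1 maps them to endomorphisms of finite support, hence into
I_1.  Modulo these, and after multiplication on the right by a power of d
(d stands for the derivation, int for the integration), every element of I_1
is a skew polynomial sum_k t_k(H) d^k ([normal_form]), and two skew
polynomials always have a nontrivial common right multiple, by a Euclidean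
elimination of leading terms ([op_common_multiple]).  It remains to turn a
nonzero skew polynomial into a bijection by a right multiplication and a
change of finite support: dividing by a power of d on the right one may assume
that t_0 is not 0; then the operator is triangular on the monomials, with
diagonal entries t_0(i+1) that vanish only finitely often, and the missing
diagonal entries are supplied by finitely many matrix units
([op_bijective_correction]).

The left-hand statements follow by the involution.  The right action of a on
K[d] is conjugate to the action of its star on K[x] through the isomorphism
d^i |-> x^i / i! ([Kd_act_star]), so J_1^0 is the image of I_1^0 under star,
and star turns right Ore sets, right fractions and right localizations into
left ones.  This gives the anti-isomorphism too, as right localizations at an
Ore set are unique ([right_localization_unique]).

The remaining negative statements all come from the single element 1 + d.  It
is triangular, hence bijective on K[x]; its star 1 + int is regular but not
surjective, as it raises degrees.  Thus 1 + int is a regular element that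
belongs to no regular right Ore set, and 1 + d, which is invertible in
Frac_r, cannot be invertible in Frac_l. *)

(** * Ore sets, fractions and localizations *)

Section OreSets.
Set Implicit Arguments.
Unset Strict Implicit.
Unset Printing Implicit Defensive.

Section RightFractions.
Variables (R A : pzRingType) (iota : R -> A) (S : set R).
Hypothesis iotaB : zmod_morphism iota.
Hypothesis iotaM : monoid_morphism iota.
Hypothesis oreS : right_Ore_set S.

(** For S inverted by iota this says that q = iota r * (iota s)^-1.  With no
inverse in it, the equation can be read componentwise when A is a product of
two rings. *)
Definition right_fraction (q : A) := exists s r, S s /\ q * iota s = iota r.

Lemma right_fraction_img r : right_fraction (iota r).
Proof. by exists 1, r; rewrite iotaM.1 mulr1; split=> //; exact: oreS.1.1. Qed.

Lemma right_fraction_inv q s : S s -> q * iota s = 1 -> right_fraction q.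
Proof. by move=> Ss E; exists s, 1; rewrite iotaM.1. Qed.

Lemma right_fractionB p q :
  right_fraction p -> right_fraction q -> right_fraction (p - q).
Proof.
move=> [s [r [Ss ps]]] [s' [r' [Ss' qs]]].
have [t [t' [St E]]] := oreS.2 s s' Ss'.
exists (s * t), (r * t - r' * t'); split; first exact: oreS.1.2.
by rewrite mulrBl iotaB {2}E !iotaM.2 !mulrA ps qs.
Qed.

Lemma right_fractionM p q :
  right_fraction p -> right_fraction q -> right_fraction (p * q).
Proof.
move=> [s [r [Ss ps]]] [s' [r' [Ss' qs]]].
have [t [v [St E]]] := oreS.2 r' s Ss.
exists (s' * t), (r * v); split; first exact: oreS.1.2.
by rewrite iotaM.2 mulrA -(mulrA p) qs -mulrA -iotaM.2 E !iotaM.2 mulrA ps.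
Qed.

Lemma right_fractionD p q :
  right_fraction p -> right_fraction q -> right_fraction (p + q).
Proof.
move=> fp fq; rewrite -[q]opprK -[- q]sub0r; apply: right_fractionB => //.
by rewrite -[0](subrr 1); do 2!apply: right_fractionB => //;
  rewrite -iotaM.1; exact: right_fraction_img.
Qed.

Lemma right_fraction_scale (e p q : A) : (exists r, e = iota r) ->
  right_fraction p -> right_fraction q -> right_fraction (e * p + q).
Proof.
move=> [r ->] fp fq; apply: right_fractionD => //.
by apply: right_fractionM => //; exact: right_fraction_img.
Qed.

End RightFractions.

Lemma gen_alg_sub (K : comNzRingType) (A : algType K) (G : set A) (P : A -> Prop) :
    P 1 -> (forall k u v, P u -> P v -> P (k *: u + v)) ->
    (forall u v, P u -> P v -> P (u * v)) -> (forall g, G g -> P g) ->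
  forall a, a \in gen_alg G -> P a.
Proof.
move=> P1 PL PM PG a /gen_algP/(_ (fun b => `[< P b >])) aB.
apply/asboolP/aB => [|g Gg]; last exact/asboolP/PG.
split=> [|k u v /asboolP Pu /asboolP Pv|u v /asboolP Pu /asboolP Pv];
  apply/asboolP; [exact: P1|exact: PL|exact: PM].
Qed.

(** The isomorphism is the map whose graph is the set of right fractions, with
common numerator and denominator, in Q1 * Q2.  The Ore condition makes this
graph a subring, and it meets Q1 * 0 and 0 * Q2 trivially because f1 and f2
have the same kernel. *)
Lemma right_localization_unique (R Q1 Q2 : pzRingType) (S : set R)
    (f1 : {rmorphism R -> Q1}) (f2 : {rmorphism R -> Q2}) :
    right_Ore_set S -> right_localization S f1 -> right_localization S f2 ->
  exists phi : {rmorphism Q1 -> Q2},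
    bijective phi /\ forall r, phi (f1 r) = f2 r.
Proof.
move=> oreS [inv1 frac1 ker1] [inv2 frac2 ker2].
pose iota r : Q1 * Q2 := (f1 r, f2 r).
have iotaB : zmod_morphism iota.
  by move=> x y; rewrite /iota !rmorphB.
have iotaM : monoid_morphism iota.
  by split=> [|x y]; rewrite /iota ?rmorph1 ?rmorphM.
pose Gr q1 q2 := right_fraction iota S (q1, q2).
have GrP q1 q2 : Gr q1 q2 <->
    exists s r, [/\ S s, q1 * f1 s = f1 r & q2 * f2 s = f2 r].
  split=> [[s [r [Ss []]]]|[s [r [Ss E1 E2]]]]; exists s, r; split=> //.
  exact: (congr2 pair E1 E2).
have GrB q1 q2 q1' q2' : Gr q1 q2 -> Gr q1' q2' -> Gr (q1 - q1') (q2 - q2').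
  by move=> G1 G2; exact: (right_fractionB iotaB iotaM oreS G1 G2).
have GrM q1 q2 q1' q2' : Gr q1 q2 -> Gr q1' q2' -> Gr (q1 * q1') (q2 * q2').
  by move=> G1 G2; exact: (right_fractionM iotaM oreS G1 G2).
have Gri r : Gr (f1 r) (f2 r) by exact: (right_fraction_img iotaM oreS r).
have Gr0l q : Gr 0 q -> q = 0.
  move=> /GrP[s [r [Ss /esym + E]]]; rewrite mul0r => /ker1/ker2 f2r.
  by have [u [_ su]] := inv2 s Ss; rewrite -[q]mulr1 -su mulrA E f2r mul0r.
have Gr0r q : Gr q 0 -> q = 0.
  move=> /GrP[s [r [Ss E /esym]]]; rewrite mul0r => /ker2/ker1 f1r.
  by have [u [_ su]] := inv1 s Ss; rewrite -[q]mulr1 -su mulrA E f1r mul0r.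
have /choice[g gP] q1 : exists q2, Gr q1 q2.
  have [r [s [u1 [Ss [us su] ->]]]] := frac1 q1; have [u2 [us2 su2]] := inv2 s Ss.
  by exists (f2 r * u2); apply/GrP; exists s, r; rewrite -!mulrA us us2 !mulr1.
have /choice[h hP] q2 : exists q1, Gr q1 q2.
  have [r [s [u2 [Ss [us su] ->]]]] := frac2 q2; have [u1 [us1 su1]] := inv1 s Ss.
  by exists (f1 r * u1); apply/GrP; exists s, r; rewrite -!mulrA us us1 !mulr1.
have gE q1 q2 : Gr q1 q2 -> g q1 = q2.
  by move=> Gq; apply/subr0_eq/Gr0l; rewrite -(subrr q1); exact: GrB.
have hE q1 q2 : Gr q1 q2 -> h q2 = q1.
  by move=> Gq; apply/subr0_eq/Gr0r; rewrite -(subrr q2); exact: GrB.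
have gB : zmod_morphism g by move=> x y; apply/gE/GrB.
have gM : monoid_morphism g.
  split=> [|x y]; apply: gE; last exact: GrM.
  by rewrite -(rmorph1 f1) -(rmorph1 f2).
pose phi : {rmorphism Q1 -> Q2} := HB.pack g
  (GRing.isZmodMorphism.Build _ _ g gB) (GRing.isMonoidMorphism.Build _ _ g gM).
exists phi; split=> [|r]; last exact: gE.
by exists h => q; [apply: hE|apply: gE].
Qed.

Section QuotientImpliesOre.
Variables (R Q : pzRingType) (f : {rmorphism R -> Q}).

Lemma right_quotient_Ore :
  right_quotient_ring f -> right_Ore_condition (@regular_elements R).
Proof.
move=> [inv frac ker] r s Cs; have [v [vs sv]] := inv s Cs.
have [u [t [w [Ct [wt tw] E]]]] := frac (v * f r).
exists t, u; split=> //; apply/subr0_eq.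
have /ker[c [_ Cc] Ec] : f (r * t - s * u) = 0.
  apply/eqP; rewrite rmorphB !rmorphM subr_eq0; apply/eqP.
  by rewrite -[f r]mul1r -sv -(mulrA (f s)) E -!mulrA wt mulr1.
exact: Cc.
Qed.

Lemma left_quotient_Ore :
  left_quotient_ring f -> left_Ore_condition (@regular_elements R).
Proof.
move=> [inv frac ker] r s Cs; have [v [vs sv]] := inv s Cs.
have [u [t [w [Ct [wt tw] E]]]] := frac (f r * v).
exists t, u; split=> //; apply/subr0_eq.
have /ker[c [Cc _] Ec] : f (t * r - u * s) = 0.
  apply/eqP; rewrite rmorphB !rmorphM subr_eq0; apply/eqP.
  by rewrite -[f r]mulr1 -vs (mulrA (f r)) E !mulrA tw mul1r.
exact: Cc.
Qed.

End QuotientImpliesOre.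

(** A largest set in the sense of a unique maximal one is obtained here in the
stronger form of a greatest element. *)
Lemma greatest_largest_right (R : pzRingType) (S : set R) :
    regular_right_Ore_set S ->
    (forall T, regular_right_Ore_set T -> T `<=` S) ->
  largest_regular_right_Ore_set S.
Proof.
move=> SO Smax; split=> [|T [TO Tmax]].
  by split=> // T TO ST; rewrite eqEsubset; split=> //; exact: Smax.
by apply/esym/Tmax => //; exact: Smax.
Qed.

Lemma greatest_largest_left (R : pzRingType) (S : set R) :
    regular_left_Ore_set S ->
    (forall T, regular_left_Ore_set T -> T `<=` S) ->
  largest_regular_left_Ore_set S.
Proof.
move=> SO Smax; split=> [|T [TO Tmax]].
  by split=> // T TO ST; rewrite eqEsubset; split=> //; exact: Smax.
by apply/esym/Tmax => //; exact: Smax.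
Qed.

Section Involution.
Variables (R : pzRingType) (sigma : R -> R).
Hypothesis sigmaB : zmod_morphism sigma.
Hypothesis sigmaM : forall a b, sigma (a * b) = sigma b * sigma a.
Hypothesis sigmaK : involutive sigma.

Let sigma0 : sigma 0 = 0. Proof. by rewrite -{1}(subrr 0) sigmaB subrr. Qed.
Let sigma1 : sigma 1 = 1.
Proof. by rewrite -[sigma 1]mulr1 -{2}[1]sigmaK -sigmaM mulr1 sigmaK. Qed.

Lemma regular_sigma a : regular a -> regular (sigma a).
Proof.
move=> [al ar]; split=> b E; apply: (inv_inj sigmaK); rewrite sigma0.
- by apply: ar; rewrite -[a]sigmaK -sigmaM E sigma0.
- by apply: al; rewrite -[a]sigmaK -sigmaM E sigma0.
Qed.

Lemma left_Ore_condition_sigma (S : set R) :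
  left_Ore_condition S -> right_Ore_condition (sigma @^-1` S).
Proof.
move=> SO r s Ss; have [t [u [St E]]] := SO (sigma r) _ Ss.
exists (sigma t), (sigma u); rewrite /= sigmaK; split=> //.
by rewrite -[r]sigmaK -[s]sigmaK -!sigmaM E.
Qed.

Lemma right_Ore_condition_sigma (S : set R) :
  right_Ore_condition S -> left_Ore_condition (sigma @^-1` S).
Proof.
move=> SO r s Ss; have [t [u [St E]]] := SO (sigma r) _ Ss.
exists (sigma t), (sigma u); rewrite /= sigmaK; split=> //.
by rewrite -[r]sigmaK -[s]sigmaK -!sigmaM E.
Qed.

Lemma mult_closed_sigma (S : set R) :
  mult_closed S -> mult_closed (sigma @^-1` S).
Proof.
by move=> [S1 SM]; split=> [|s t Ss St] /=; rewrite ?sigma1 // sigmaM; exact: SM.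
Qed.

Lemma regular_sub_sigma (S : set R) :
  S `<=` @regular_elements R -> sigma @^-1` S `<=` @regular_elements R.
Proof. by move=> SC s /SC/regular_sigma; rewrite sigmaK. Qed.

Lemma regular_left_Ore_set_sigma (S : set R) :
  regular_left_Ore_set S -> regular_right_Ore_set (sigma @^-1` S).
Proof.
move=> [[SM SO] SC]; split; last exact: regular_sub_sigma.
by split; [exact: mult_closed_sigma|exact: left_Ore_condition_sigma].
Qed.

Lemma regular_right_Ore_set_sigma (S : set R) :
  regular_right_Ore_set S -> regular_left_Ore_set (sigma @^-1` S).
Proof.
move=> [[SM SO] SC]; split; last exact: regular_sub_sigma.
by split; [exact: mult_closed_sigma|exact: right_Ore_condition_sigma].
Qed.

(** A left localization composed with an anti-automorphism becomes a right
localization in the converse ring. *)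
Section Twist.
Variables (Q : pzRingType) (f : {rmorphism R -> Q}).

Definition twist (r : R) : Q^c := f (sigma r).

Fact twist_zmod : zmod_morphism twist.
Proof. by move=> a b; rewrite /twist sigmaB rmorphB. Qed.
Fact twist_monoid : monoid_morphism twist.
Proof.
split=> [|a b]; rewrite /twist; first by rewrite sigma1 rmorph1.
by rewrite sigmaM rmorphM.
Qed.
HB.instance Definition _ := GRing.isZmodMorphism.Build R Q^c twist twist_zmod.
HB.instance Definition _ :=
  GRing.isMonoidMorphism.Build R Q^c twist twist_monoid.

Lemma left_localization_sigma (S : set R) : left_localization S f ->
  right_localization (sigma @^-1` S) (twist : {rmorphism R -> Q^c}).
Proof.
move=> [inv frac ker]; split=> [s Ss|q|r].
- by have [u [us su]] := inv _ Ss; exists u.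
- have [r [s [u [Ss [us su] ->]]]] := frac q.
  by exists (sigma r), (sigma s), u; rewrite /= /twist !sigmaK.
- rewrite /= /twist ker; split=> -[s Ss E]; exists (sigma s) => //.
  + by rewrite /= sigmaK.
  + by rewrite -[r]sigmaK -sigmaM E.
  + by rewrite -sigmaM E.
Qed.

End Twist.
End Involution.

End OreSets.

(** * Endomorphisms of finite support *)
Section Operators.
Set Implicit Arguments.
Unset Strict Implicit.
Unset Printing Implicit Defensive.
Variable K : fieldType.
Implicit Types (p q v : {poly K}) (a b c : I1 K) (f g : endpoly K).

Lemma bij_inverse f : bijective f -> exists g, inverse_of g f.
Proof.
move=> [h fK hK]; exists (Endpoly (can2_linear fK hK)).
by split; apply: endpoly_eq => p; rewrite endpoly_mulE /= ?fK ?hK.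
Qed.

Lemma poly_monomials n p : (size p <= n)%N -> p = \sum_(i < n) p`_i *: 'X^i.
Proof.
move=> pn; rewrite -poly_def; apply/polyP => i; rewrite coef_poly.
by case: ltnP => // ni; rewrite nth_default // (leq_trans pn).
Qed.

Lemma endpoly_monomials f p n : (size p <= n)%N -> f p = \sum_(i < n) p`_i *: f 'X^i.
Proof.
move=> pn; rewrite {1}(poly_monomials pn) linear_sum.
by apply: eq_bigr => i _; rewrite linearZ.
Qed.

Lemma triangular_size f p :
  (forall n, size (f 'X^n) = n.+1) -> size (f p) = size p.
Proof.
move=> fX; have [->|p0] := eqVneq p 0; first by rewrite linear0.
case sp: (size p) => [|n]; first by move/eqP: sp; rewrite size_poly_eq0 (negPf p0).
rewrite (endpoly_monomials f (eq_leq sp)) big_ord_recr /= addrC.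
have lp : p`_n != 0 by rewrite -lead_coef_eq0 /lead_coef sp in p0.
rewrite size_polyDl size_scale // fX // ltnS.
apply: leq_trans (size_sum _ _ _) _.
apply/bigmax_leqP => i _; apply: leq_trans (size_scale_leq _ _) _.
by rewrite fX.
Qed.

(** Preserving degrees gives injectivity at once; surjectivity follows by
successive cancellation of the leading term. *)
Lemma triangular_bij f : (forall n, size (f 'X^n) = n.+1) -> bijective f.
Proof.
move=> fX; have fS p := triangular_size p fX.
have f0 p : f p = 0 -> p = 0.
  by move=> E; apply/eqP; rewrite -size_poly_eq0 -fS E size_poly0.
have fsurj n p : (size p <= n)%N -> exists q, f q = p.
  elim: n p => [|n IH] p pn.
    by exists 0; rewrite linear0; apply/esym/eqP; rewrite -size_poly_eq0 -leqn0.
  have l0 : (f 'X^n)`_n != 0.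
    by have := lead_coef_eq0 (f 'X^n); rewrite /lead_coef fX /= => ->;
      rewrite -size_poly_eq0 fX.
  pose k := p`_n / (f 'X^n)`_n.
  have [|q fq] := IH (p - k *: f 'X^n).
    apply/leq_sizeP => j; rewrite leq_eqVlt coefB coefZ => /predU1P[<-|nj].
      by rewrite divfK // subrr.
    by rewrite !(leq_sizeP _ n.+1 _) ?fX // mulr0 subrr.
  by exists (q + k *: 'X^n); rewrite linearD linearZ /= fq subrK.
have /choice[g gP] p : exists q, f q = p by exact: fsurj (leqnn _).
exists g => p //; apply/subr0_eq/f0.
by rewrite linearB /= gP subrr.
Qed.

Definition low0 n p := forall i, (i < n)%N -> p`_i = 0.
(** These are the finite matrices in the basis of monomials, which form the
ideal of I_1 generated by 1 - int d. *)
Definition finite_support f := exists n, forall p, low0 n p -> f p = 0.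
Notation finI a := (finite_support (val a : endpoly K)).

Lemma low0W n m p : (n <= m)%N -> low0 m p -> low0 n p.
Proof. by move=> nm pm i ni; apply: pm; exact: leq_trans ni nm. Qed.

(** Elements of I_1 lower the order of vanishing at 0 by a bounded amount.
This is what makes finite support stable under composition with I_1 on the
right. *)
Lemma I1_low0 a : exists d, forall n p, low0 (n + d) p -> low0 n ((val a : endpoly K) p).
Proof.
elim/I1_ind: a => [|k u v [d Hu] [e Hv]|u v [d Hu] [e Hv]|||].
- by exists 0%N => n p; rewrite addn0 I1_val1.
- exists (d + e)%N => n p np i ni.
  rewrite I1_valD I1_valZ endpoly_addE endpoly_scaleE coefD coefZ.
  rewrite (Hu n) ?(Hv n) ?mulr0 ?addr0 //; apply: low0W np.
    by rewrite leq_add2l leq_addl.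
  by rewrite leq_add2l leq_addr.
- exists (d + e)%N => n p np; rewrite I1_valM endpoly_mulE.
  by apply: Hu; apply: Hv; rewrite -addnA.
- exists 0%N => n p; rewrite addn0 => np i ni; rewrite /= coefXM.
  by case: i ni => //= i ni; apply: np; exact: ltnW.
- exists 1%N => n p np i ni; rewrite /= coef_deriv np ?mul0rn //.
  by rewrite addn1 ltnS.
- exists 0%N => n p; rewrite addn0 => np i ni; rewrite /= coef_poly_int.
  by case: i ni => // i ni; rewrite np ?mul0r // ltnW.
Qed.

Lemma finite_support0 : finite_support 0.
Proof. by exists 0%N. Qed.

Lemma finite_supportD f g :
  finite_support f -> finite_support g -> finite_support (f + g).
Proof.
move=> [n fn] [m gm]; exists (n + m)%N => p np.
by rewrite endpoly_addE fn ?gm ?addr0 //; apply: low0W np; rewrite ?leq_addl ?leq_addr.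
Qed.

Lemma finite_supportMl f g : finite_support g -> finite_support (f * g).
Proof.
by move=> [n gn]; exists n => p np; rewrite endpoly_mulE gn // linear0.
Qed.

Lemma finite_supportB f g :
  finite_support f -> finite_support g -> finite_support (f - g).
Proof.
move=> Ff Fg; rewrite -mulN1r.
by apply: finite_supportD => //; exact: finite_supportMl.
Qed.

Lemma finite_supportMr f a : finite_support f -> finite_support (f * val a).
Proof.
move=> [n fn]; have [d ad] := I1_low0 a; exists (n + d)%N => p np.
by rewrite endpoly_mulE fn //; exact: ad.
Qed.

Lemma finite_support_cancel f g :
  injective f -> finite_support (f * g) -> finite_support g.
Proof.
move=> finj [n fgn]; exists n => p np; apply: finj.
by rewrite -endpoly_mulE fgn // linear0.
Qed.

Hypothesis charK : [pchar K] =i pred0.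

Lemma horner_algMXaddC (A : algType K) (a : A) p (c : K) :
  horner_alg a (p * 'X + c%:P) = horner_alg a p * a + c%:A.
Proof. by rewrite rmorphD rmorphM /= horner_algX horner_algC. Qed.

(** The rank one operator p |-> p`_i v: the factor 1 - int d is the evaluation
at 0, so d^i / i! followed by it extracts the coefficient of index i. *)
Definition single v i : I1 K :=
  horner_alg (I1_x K) v * (1 - I1_int K * I1_d K) * I1_d K ^+ i *
  (i`!%:R^-1)%:A.

Lemma horner_alg_xE p q : (val (horner_alg (I1_x K) p) : endpoly K) q = p * q.
Proof.
elim/poly_ind: p q => [|p c IH] q; first by rewrite rmorph0 mul0r.
rewrite horner_algMXaddC I1_valD I1_valM I1_valZ.
by rewrite I1_val1 endpoly_addE endpoly_mulE IH /= mulrDl mulrA mul_polyC.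
Qed.

Lemma I1_valB a b : val (a - b) = (val a : endpoly K) - val b.
Proof. exact: rmorphB. Qed.

Lemma eval0E p : (val (1 - I1_int K * I1_d K) : endpoly K) p = (p`_0)%:P.
Proof.
rewrite I1_valB I1_valM I1_val1.
change (p - poly_int p^`() = (p`_0)%:P); apply/polyP => i; rewrite coefB coef_poly_int coefC; case: i => [|i]; first by rewrite subr0.
by rewrite /= coef_deriv -[p`_i.+1 *+ _]mulr_natr mulfK ?Defs.natS_neq0 // subrr.
Qed.

Lemma I1_dXn n p : (val (I1_d K ^+ n) : endpoly K) p = p^`(n).
Proof.
elim: n p => [|n IH] p; first by rewrite expr0 I1_val1.
by rewrite exprSr I1_valM endpoly_mulE IH -derivSn.
Qed.

Lemma singleE v i p : (val (single v i) : endpoly K) p = p`_i *: v.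
Proof.
rewrite /single !I1_valM !endpoly_mulE I1_valZ I1_val1 endpoly_scaleE endpoly_1E.
rewrite I1_dXn eval0E horner_alg_xE derivnZ coefZ coef_derivn addn0 ffactnn.
by rewrite -[p`_i *+ _]mulr_natl mulKf ?Defs.fact_neq0 // mulrC mul_polyC.
Qed.

Lemma finite_support_I1 f : finite_support f -> exists a, val a = f.
Proof.
move=> [n fn]; exists (\sum_(i < n) single (f 'X^i) i).
apply: endpoly_eq => p.
have -> : (val (\sum_(i < n) single (f 'X^i) i) : endpoly K) p =
    \sum_(i < n) p`_i *: f 'X^i.
  elim/big_rec2: _ => [|i q a _ IH]; first by rewrite rmorph0.
  by rewrite I1_valD endpoly_addE singleE IH.
have -> : f p = f (\poly_(i < n) p`_i).
  apply/subr0_eq; rewrite -linearB /=; apply: fn => i ni.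
  by rewrite coefB coef_poly ni subrr.
rewrite poly_def linear_sum; apply: eq_bigr => i _.
by rewrite linearZ.
Qed.

Lemma I1_0_regular a : I1_0 a -> regular a.
Proof.
move=> [g aK gK]; split=> b E; apply: val_inj; apply: endpoly_eq => p.
- apply: (can_inj aK); rewrite -endpoly_mulE -I1_valM E rmorph0.
  by rewrite [RHS]linear0.
- by rewrite -[p]gK -endpoly_mulE -I1_valM E rmorph0.
Qed.

(** For a nonzero v, take r = single v 0, whose image is the line of v.  The Ore
condition gives r t = s u with t regular, so r t is nonzero, and the image of
s contains v.  Injectivity of s is regularity tested against the same rank one
operators. *)
Lemma regular_right_Ore_I1_0 (S : set (I1 K)) :
  S `<=` @regular_elements (I1 K) -> right_Ore_condition S -> S `<=` @I1_0 K.
Proof.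
move=> SC SO s Ss.
have s0 v : (val s : endpoly K) v = 0 -> v = 0.
  move=> sv; have := (SC s Ss).1 (single v 0).
  have -> : s * single v 0 = 0.
    apply: val_inj; apply: endpoly_eq => p.
    by rewrite rmorph0 I1_valM endpoly_mulE singleE linearZ /= sv scaler0.
  move=> /(_ erefl)/(congr1 (fun a => (val a : endpoly K) 1)).
  by rewrite singleE coef1 scale1r rmorph0.
have ssurj v : exists p, (val s : endpoly K) p = v.
  have [->|v0] := eqVneq v 0; first by exists 0; rewrite linear0.
  have [t [u [St E]]] := SO (single v 0) s Ss.
  (* r t is nonzero because t is right regular and r is nonzero *)
  have [p] : exists p, (val (single v 0 * t) : endpoly K) p <> 0.
    apply/not_existsP => /= st0; have e0 : single v 0 = 0.
      apply: (SC t St).2; apply: val_inj; apply: endpoly_eq => p.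
      by rewrite rmorph0; apply: contrapT; exact: st0.
    have := singleE v 0 1; rewrite e0 rmorph0 coef1 scale1r => /esym/eqP.
    by rewrite (negPf v0).
  rewrite {1}I1_valM endpoly_mulE singleE; set k := _`_0 => kv.
  have k0 : k != 0 by apply: contra_notN kv => /eqP ->; rewrite scale0r.
  exists (k^-1 *: (val u : endpoly K) p).
  rewrite linearZ /= -endpoly_mulE -I1_valM -E I1_valM endpoly_mulE singleE.
  by rewrite scalerA mulVf // scale1r.
have /choice[g gP] := ssurj.
exists g => p //; apply/subr0_eq/s0.
by rewrite linearB /= gP subrr.
Qed.

End Operators.

(** * Skew polynomials in d with coefficients in K[H] *)

Section SkewPolynomials.
Set Implicit Arguments.
Unset Strict Implicit.
Unset Printing Implicit Defensive.
Variable K : fieldType.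
Implicit Types (p q c : {poly K}) (a b : I1 K) (f g : endpoly K).
Implicit Types (r s t u w : {poly {poly K}}).
Hypothesis charK : [pchar K] =i pred0.
Notation x := (I1_x K).
Notation d := (I1_d K).
Notation H := (I1_H K).
Notation int := (I1_int K).
Notation finI a := (finite_support (val a : endpoly K)).

(** An element t of K[H][X] stands for the operator sum_k t_k(H) d^k,
coefficients on the left.  The product of such operators is the skew one given
by d c(H) = c(H + 1) d. *)
Definition op t : I1 K := (map_poly (horner_alg H) t).[d].

Lemma opD s t : op (s + t) = op s + op t.
Proof. by rewrite /op rmorphD hornerD. Qed.
Lemma opB s t : op (s - t) = op s - op t.
Proof. by apply/eqP; rewrite eq_sym subr_eq -opD subrK. Qed.
Lemma op0 : op 0 = 0. Proof. by rewrite /op rmorph0 horner0. Qed.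
Lemma opC c : op c%:P = horner_alg H c.
Proof. by rewrite /op map_polyC hornerC. Qed.
Lemma opMX t : op (t * 'X) = op t * d.
Proof. by rewrite /op rmorphM /= map_polyX hornerMX. Qed.
Lemma opCM c t : op (c%:P * t) = horner_alg H c * op t.
Proof. by rewrite /op rmorphM /= map_polyC hornerCM. Qed.
Lemma opMXn t n : op (t * 'X^n) = op t * d ^+ n.
Proof.
elim: n => [|n IH]; first by rewrite !expr0 !mulr1.
by rewrite !exprSr !mulrA opMX IH.
Qed.
Lemma op_expand t n : (size t <= n)%N ->
  op t = \sum_(k < n) horner_alg H t`_k * d ^+ k.
Proof.
move=> tn; rewrite /op (@horner_coef_wide _ n) ?(leq_trans (size_poly _ _)) //.
by apply: eq_bigr => k _; rewrite coef_map.
Qed.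

Notation shift k := (comp_poly ('X + k%:R%:P)).

Lemma d_H : d * H = (H + 1) * d.
Proof.
apply: val_inj; apply: endpoly_eq => p.
rewrite !I1_valM !endpoly_mulE I1_valD I1_valM I1_val1.
rewrite endpoly_addE endpoly_mulE endpoly_1E /=.
by rewrite !(derivM, derivD, derivX, mul1r) addrC.
Qed.

Lemma dXn_H n : d ^+ n * H = (H + n%:R) * d ^+ n.
Proof.
elim: n => [|n IH]; first by rewrite expr0 mulr1 mul1r addr0.
rewrite exprS -mulrA IH mulrA mulrDr d_H mulr_natr -mulr_natl -mulrDl -mulrA.
by rewrite -exprS -addrA nat1r.
Qed.

Lemma dXn_horner_H p n :
  d ^+ n * horner_alg H p = horner_alg H (shift n p) * d ^+ n.
Proof.
elim/poly_ind: p => [|p c IH].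
  by rewrite comp_poly0 rmorph0 mulr0 mul0r.
rewrite comp_poly_MXaddC horner_algMXaddC mulrDr mulrA IH -mulrA dXn_H.
rewrite mulrA -scalerAr mulr1 -mulr_algl -mulrDl; congr (_ * _).
rewrite rmorphD rmorphM /= horner_algC; congr (_ * _ + _).
by rewrite rmorphD /= horner_algX horner_algC -in_algE rmorph_nat.
Qed.

(** Left multiplication by d, read on skew polynomials. *)
Definition dmul t := map_poly (shift 1) t * 'X.

Lemma op_dmul t : op (dmul t) = d * op t.
Proof.
rewrite /dmul opMX; elim/poly_ind: t => [|t c IH].
  by rewrite rmorph0 op0 mulr0 mul0r.
rewrite rmorphD rmorphM /= map_polyX map_polyC !opD !opMX !opC mulrDr mulrA -IH.
by rewrite mulrDl; congr (_ + _); rewrite -[d in RHS]expr1 dXn_horner_H.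
Qed.

Lemma dmul_eq0 t : dmul t = 0 -> t = 0.
Proof.
move=> /eqP; rewrite mulf_eq0 polyX_eq0 orbF; have [//|t0] := eqVneq t 0.
rewrite map_poly_eq0_id0 ?(negPf t0) //.
by rewrite comp_poly2_eq0 ?lead_coef_eq0 // size_XaddC.
Qed.

Lemma op_iter_dmul n t : op (iter n dmul t) = d ^+ n * op t.
Proof.
by elim: n => [|n IH]; rewrite ?expr0 ?mul1r //= op_dmul IH mulrA -exprS.
Qed.

Lemma iter_dmul_eq0 n t : iter n dmul t = 0 -> t = 0.
Proof. by elim: n => //= n IH /dmul_eq0. Qed.

Lemma op_mul r t : exists w, op r * op t = op w.
Proof.
elim/poly_ind: r t => [|r c IH] t; first by exists 0; rewrite op0 mul0r.
have [w Ew] := IH (dmul t); exists (w + c%:P * t).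
by rewrite !opD opMX opC opCM mulrDl -mulrA -op_dmul Ew.
Qed.

Lemma op_dXn_comm m t : exists w, op t * d ^+ m = d ^+ m * op w.
Proof.
elim: m t => [|m IH] t; first by exists t; rewrite expr0 mulr1 mul1r.
have [w Ew] := IH (map_poly (comp_poly ('X - 1%:P)) t).
exists w; rewrite exprS -mulrA -Ew !mulrA; congr (_ * _).
rewrite -op_dmul -opMX /dmul; congr (op (_ * _)).
rewrite -map_poly_comp_id0 ?comp_poly0 //; apply/polyP => i.
rewrite coef_map_id0 /= ?comp_poly0 // -comp_polyA comp_polyB comp_polyX.
by rewrite comp_polyC addrK comp_polyXr.
Qed.

Lemma coef_horner_H c p j :
  ((val (horner_alg H c) : endpoly K) p)`_j = c.[j.+1%:R] * p`_j.
Proof.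
elim/poly_ind: c p => [|c k IH] p; first by rewrite rmorph0 horner0 mul0r coef0.
rewrite horner_algMXaddC I1_valD I1_valM I1_valZ I1_val1 endpoly_addE.
rewrite endpoly_mulE endpoly_scaleE endpoly_1E coefD IH coefZ.
rewrite I1_valM endpoly_mulE /= coef_deriv coefXM /=.
by rewrite hornerMXaddC mulrDl -[p`_j *+ _]mulr_natl mulrA.
Qed.

Lemma coef_op t p j n : (size t <= n)%N ->
  ((val (op t) : endpoly K) p)`_j =
  \sum_(k < n) (t`_k).[j.+1%:R] * (p`_(k + j) *+ (k + j) ^_ k).
Proof.
move=> tn; rewrite (op_expand tn).
elim/big_rec2: _ => [|k q a _ IH]; first by rewrite rmorph0 coef0.
by rewrite I1_valD endpoly_addE coefD -IH I1_valM endpoly_mulE coef_horner_H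
  I1_dXn coef_derivn.
Qed.

Lemma coef_op_Xn t i k : (k <= i)%N ->
  ((val (op t) : endpoly K) 'X^i)`_(i - k) =
  (t`_k).[(i - k).+1%:R] * (i ^_ k)%:R.
Proof.
move=> ki; rewrite (@coef_op _ _ _ (size t + k.+1)) ?leq_addr //.
have kn : (k < size t + k.+1)%N by rewrite addnS ltnS leq_addl.
rewrite (bigD1 (Ordinal kn)) //= subnKC // coefXn eqxx big1 ?addr0 // => l lk.
rewrite coefXn -[X in _ == X](subnKC ki) eqn_add2r.
by have -> : (l == k :> nat) = false := negPf lk; rewrite mul0rn mulr0.
Qed.

(** In characteristic 0 the integers are infinitely many points, so a nonzero
polynomial vanishes at finitely many of them. *)
Lemma horner_nat_eventually_neq0 c : c != 0 ->
  exists N, forall i, (N <= i)%N -> c.[i.+1%:R] != 0.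
Proof.
have [n] := ubnP (size c); elim: n c => // n IH c cn c0.
have [[i /eqP ci]|nr] := pselect (exists i, c.[i.+1%:R] == 0); last first.
  by exists 0%N => i _; apply/negP => ci; apply: nr; exists i.
have /factor_theorem[q cq] : root c i.+1%:R by apply/eqP.
have q0 : q != 0 by apply: contra_neq c0 => q0; rewrite cq q0 mul0r.
have [|N NP] := IH q _ q0.
  by move: cn; rewrite cq size_Mmonic ?monicXsubC // size_XsubC addn2 ltnS.
exists (maxn N i.+1) => j; rewrite geq_max => /andP[Nj ij].
rewrite cq hornerM hornerXsubC mulf_neq0 ?NP //.
rewrite -natrB ?ltnS 1?ltnW // subSS -(prednK (n := j - i)) ?subn_gt0 //.
exact: Defs.natS_neq0.
Qed.

(** On x^i the terms t_k(H) d^k have distinct degrees, so t_k vanishes at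
i - k + 1 for all large i. *)
Lemma op_finite_support_eq0 t : finI (op t) -> t = 0.
Proof.
move=> [n tn]; apply/polyP => k; rewrite coef0; apply/eqP/negPn/negP => tk0.
have [N NP] := horner_nat_eventually_neq0 tk0.
pose i := (n + N + k)%N; have ki : (k <= i)%N by rewrite leq_addl.
have := coef_op_Xn t ki; rewrite tn => [|j jn]; last first.
  by rewrite coefXn ltn_eqF // /i -addnA ltn_addr.
rewrite coef0 => /esym/eqP; rewrite mulf_eq0 => /orP[].
  by apply/negP/NP; rewrite /i addnK leq_addl.
rewrite -[X in X == _]mulr1n; apply/negP.
have : (i ^_ k)%:R * (i - k)`!%:R != 0 :> K.
  by rewrite -natrM ffact_fact // Defs.fact_neq0.
by rewrite mulf_eq0 => /norP[].
Qed.

(** The set of the a of this form contains the generators, since x d = H - 1 and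
int d - 1 has finite support.  For a product u v, the skew polynomial r of v is
moved across a power of d so that it meets the power of d required by u. *)
Lemma normal_form a : exists m t, finI (a * d ^+ m - op t).
Proof.
have nfW b m t n : finI (b * d ^+ m - op t) ->
    finI (b * d ^+ (m + n) - op (t * 'X^n)).
  move=> F; have := finite_supportMr (d ^+ n) F; rewrite -I1_valM.
  by rewrite mulrBl -mulrA -exprD -opMXn.
elim/I1_ind: a => [|k u v [m [t Hu]] [n [r Hv]]|u v [m [t Hu]] [n [r Hv]]|||].
- exists 0%N, 1; rewrite expr0 mulr1 opC rmorph1 subrr rmorph0.
  exact: finite_support0.
- exists (m + n)%N, (k%:P%:P * (t * 'X^n) + r * 'X^m).
  have := finite_supportD (finite_supportMl (k%:A : endpoly K) (nfW _ _ _ n Hu))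
                         (nfW _ _ _ m Hv).
  rewrite [(n + m)%N]addnC.
  have <- : val (k%:A : I1 K) = k%:A :> endpoly K by rewrite I1_valZ I1_val1.
  rewrite -I1_valM -I1_valD; congr finite_support; congr (val _).
  rewrite opD opCM horner_algC mulrBr mulr_algl mulrDl opprD -scalerAl.
  by rewrite !addrA; congr (_ - _); rewrite addrAC mul1r scalerAl.
- have [w Ew] := op_dXn_comm m r; have [w' Ew'] := op_mul t w.
  exists (n + m)%N, w'; rewrite exprD -Ew'.
  have -> : u * v * (d ^+ n * d ^+ m) - op t * op w =
      u * (v * d ^+ n - op r) * d ^+ m + (u * d ^+ m - op t) * op w.
    rewrite !(mulrBl, mulrBr) -[u * op r * _]mulrA Ew !mulrA.
    by rewrite [RHS]addrA subrK.
  rewrite I1_valD; apply: finite_supportD; rewrite I1_valM.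
    by apply: finite_supportMr; rewrite I1_valM; exact: finite_supportMl.
  exact: finite_supportMr.
- (* x d = H - 1 *)
  exists 1%N, ('X - 1)%:P; rewrite opC.
  rewrite (_ : _ - _ = 0); first by rewrite rmorph0; exact: finite_support0.
  rewrite rmorphB /= horner_algX rmorph1 expr1; apply/eqP; rewrite subr_eq0.
  apply/eqP/val_inj; apply: endpoly_eq => p.
  rewrite I1_valB !I1_valM I1_val1 /=.
  change ('X * p^`() = ('X * p)^`() - p).
  by rewrite derivM derivX mul1r [p + _]addrC addrK.
- exists 0%N, 'X; rewrite expr0 mulr1 -['X]mul1r opMX opC rmorph1 mul1r subrr.
  by rewrite rmorph0; exact: finite_support0.
- exists 1%N, 1; rewrite expr1 opC rmorph1 -opprB rmorphN.
  exists 1%N => p /(_ 0%N isT) p0.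
  change (- (val (1 - int * d) : endpoly K) p = 0).
  by rewrite eval0E // p0 oppr0.
Qed.

(** The product of the skew polynomial r by the coefficient p on the right. *)
Definition mul_coef_right r p := \poly_(k < size r) (r`_k * shift k p).

Lemma op_mul_coef_right r p : op (mul_coef_right r p) = op r * horner_alg H p.
Proof.
rewrite (op_expand (leqnn (size r))) (op_expand (size_poly _ _)) mulr_suml.
apply: eq_bigr => k _; rewrite coef_poly ltn_ord rmorphM /= -!mulrA.
by rewrite dXn_horner_H.
Qed.

Lemma shift_linear_eq0 p k : (p \Po ('X + k%:P) == 0) = (p == 0).
Proof. by rewrite comp_poly2_eq0 // size_XaddC. Qed.

(** Subtracting from r p(H) the product s q(H) d^j, with p and q chosen so that
the leading coefficients agree, lowers the size of r; a common multiple of the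
difference and of s yields one of r and s.  The statement is symmetric and
covers zero arguments, so the larger of the two can always be reduced. *)
Lemma op_common_multiple r s :
  exists t u, (t != 0) || (u != 0) /\ op r * op t = op s * op u.
Proof.
have [n] := ubnP (size r + size s); elim: n r s => // n IH r s rsn.
wlog sr : r s rsn / (size s <= size r)%N.
  move=> W; case: (leqP (size s) (size r)) => [rs|/ltnW sr]; first by move: (W r s rsn rs).
  have [|t [u [tu E]]] := W s r _ sr; first by rewrite addnC.
  by exists u, t; rewrite orbC.
have [->|s0] := eqVneq s 0.
  by exists 0, 1; rewrite oner_eq0 orbT op0 mulr0 mul0r.
have ss : (0 < size s)%N by rewrite lt0n size_poly_eq0.
have r_gt0 : (0 < size r)%N by exact: leq_trans ss sr.
pose m := (size r).-1; pose l := (size s).-1; pose j := (size r - size s)%N.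
have mlj : m = (l + j)%N by rewrite /m /l /j; lia.
(* p(H + m) = s_l and q(H + l) = r_m equalize the two leading coefficients *)
pose p := s`_l \Po ('X - m%:R%:P); pose q := r`_m \Po ('X - l%:R%:P).
have shiftK c k : shift k (c \Po ('X - k%:R%:P)) = c.
  by rewrite -comp_polyA comp_polyB comp_polyX comp_polyC addrK comp_polyXr.
pose r' := mul_coef_right r p - mul_coef_right s q * 'X^j.
have [|t [u [tu E]]] := IH r' s.
  apply: leq_trans (_ : (m + size s < n)%N); last by rewrite /m; lia.
  rewrite ltnS leq_add2r; apply/leq_sizeP => i mi.
  rewrite coefB coefMXn !coef_poly.
  case: ltnP => ir; last first.
    rewrite sub0r; case: ltnP => ij; first by rewrite oppr0.
    have sij : (size s <= i - j)%N by rewrite /j in ij *; lia.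
    by rewrite ltnNge sij oppr0.
  have -> : i = m by rewrite /m in mi *; lia.
  rewrite {3}mlj ltnNge leq_addl /= mlj addnK -mlj prednK // leqnn.
  by rewrite !shiftK mulrC subrr.
exists (p%:P * t), (u + q%:P * iter j dmul t); split.
  have p0 : p != 0 by rewrite /p -polyCN shift_linear_eq0 -lead_coefE lead_coef_eq0.
  have [t0|t0] := eqVneq t 0; last by rewrite mulf_neq0 // polyC_eq0.
  move: tu; rewrite t0 eqxx /= => u0; apply/orP; right.
  suff -> : iter j dmul 0 = 0 by rewrite mulr0 addr0.
  by elim: (j) => //= k ->; rewrite /dmul rmorph0 mul0r.
rewrite opD !opCM op_iter_dmul mulrDr -E /r' opB opMXn !op_mul_coef_right mulrBl.
by rewrite !mulrA subrK.
Qed.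

Lemma coef_op_Xn_diag t i :
  ((val (op t) : endpoly K) 'X^i)`_i = (t`_0).[i.+1%:R].
Proof. by have := coef_op_Xn t (leq0n i); rewrite subn0 ffactn0 mulr1. Qed.

Lemma size_op_Xn t i : (size ((val (op t) : endpoly K) 'X^i) <= i.+1)%N.
Proof.
apply/leq_sizeP => j ij; rewrite (@coef_op _ _ _ (size t)) // big1 // => k _.
by rewrite coefXn gtn_eqF ?mul0rn ?mulr0 // ltn_addl.
Qed.

(** The matrix of op t on the monomials is triangular with i-th diagonal entry
t_0(i + 1).  Only finitely many of these vanish, and adding the matrix units at
these places makes every diagonal entry nonzero. *)
Lemma op_bijective_correction t : t`_0 != 0 ->
  exists2 T, I1_0 T & finI (T - op t).
Proof.
move=> /horner_nat_eventually_neq0[N tN].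
pose g : I1 K := \sum_(i < N | (t`_0).[i.+1%:R] == 0) single 'X^i i.
have gX j : (val g : endpoly K) 'X^j =
    (if (t`_0).[j.+1%:R] == 0 then 'X^j else 0).
  transitivity (\sum_(i < N | (t`_0).[i.+1%:R] == 0) (i == j :> nat)%:R *: 'X^i
      : {poly K}).
    rewrite /g; elim/big_rec2: _ => [|i q a _ IH]; first by rewrite rmorph0.
    by rewrite I1_valD endpoly_addE singleE // coefXn IH.
  case: ifPn => [tj|tj]; last first.
    rewrite big1 // => i ti; have [ij|_] := eqVneq (i : nat) j.
      by rewrite -ij ti in tj.
    by rewrite scale0r.
  have jN : (j < N)%N by rewrite ltnNge; apply/negP => /tN; rewrite tj.
  rewrite (bigD1 (Ordinal jN)) //= eqxx scale1r big1 ?addr0 // => i /andP[_ ij].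
  by have -> : (i == j :> nat) = false := negPf ij; rewrite scale0r.
exists (op t + g); last first.
  rewrite addrC addKr; exists N => p pN; rewrite /g.
  elim/big_rec: _ => [|i a _ IH]; first by rewrite rmorph0.
  by rewrite I1_valD endpoly_addE IH singleE // pN // scale0r addr0.
apply: triangular_bij => i; rewrite I1_valD endpoly_addE gX.
apply/eqP; rewrite eqn_leq; apply/andP; split.
  rewrite (leq_trans (size_polyD _ _)) // geq_max size_op_Xn.
  by case: ifP => _; rewrite /= ?size_polyXn ?size_poly0.
rewrite ltnNge; apply/negP => /leq_sizeP/(_ i (leqnn i))/eqP.
rewrite coefD coef_op_Xn_diag; case: ifPn => [/eqP ->|t0].
  by rewrite coefXn eqxx add0r oner_eq0.
by rewrite coef0 addr0 (negPf t0).
Qed.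

Lemma op_mulXn_int t n : op (t * 'X^n) * int ^+ n = op t.
Proof.
rewrite opMXn -mulrA; suff -> : d ^+ n * int ^+ n = 1 by rewrite mulr1.
elim: n => [|n IH]; first by rewrite mulr1.
by rewrite exprSr exprS mulrA -(mulrA _ d) I1_d_int // mulr1.
Qed.

Lemma factor_power_X t : t != 0 -> exists n t', t = t' * 'X^n /\ t'`_0 != 0.
Proof.
have [n] := ubnP (size t); elim: n t => // n IH t tn t_neq0.
have [t0|t0] := eqVneq t`_0 0; last by exists 0%N, t; rewrite mulr1.
have : root t 0 by rewrite /root horner_coef0 t0.
move=> /factor_theorem[q]; rewrite subr0 => tq.
have q0 : q != 0 by apply: contra_neq t_neq0 => q0; rewrite tq q0 mul0r.
have [|m [t' [qt' t'0]]] := IH q _ q0.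
  by move: tn; rewrite tq size_mulX // ltnS.
by exists m.+1, t'; rewrite exprSr mulrA -qt'.
Qed.

(** With a d^m and b d^n replaced by skew polynomials r and s, a common multiple
r t = s u gives a (d^m t) = b (d^n u) up to finite support.  Then d^m t is
made bijective as above, at the cost of a further error of finite support, and
since b is bijective the total error is of the form b e with e of finite
support, so that e lies in I_1 and is absorbed in the cofactor of b. *)
Lemma I1_0_right_Ore_condition : right_Ore_condition (@I1_0 K).
Proof.
move=> a b b_bij; have b_inj : injective (val b : endpoly K) := bij_inj b_bij.
have [m [r ar]] := normal_form a; have [n [s bs]] := normal_form b.
have [t [u [tu E]]] := op_common_multiple r s.
(* if t = 0 then b d^n (op u) has finite support, and so has d^n (op u) *)
have t_neq0 : t != 0.
  apply/eqP => t0; move: tu; rewrite t0 eqxx /= => /eqP; apply.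
  apply: (@iter_dmul_eq0 n); apply: op_finite_support_eq0.
  rewrite op_iter_dmul; apply: (finite_support_cancel b_inj); rewrite -I1_valM mulrA.
  have -> : b * d ^+ n * op u = (b * d ^+ n - op s) * op u.
    by rewrite mulrBl -E t0 op0 mulr0 subr0.
  by rewrite I1_valM; exact: finite_supportMr.
have [j [t1 [tj t1_0]]] : exists j t1, iter m dmul t = t1 * 'X^j /\ t1`_0 != 0.
  apply: factor_power_X; apply: contra_neq t_neq0; exact: iter_dmul_eq0.
have [T T_bij Tt] := op_bijective_correction t1_0.
pose c := d ^+ n * op u * int ^+ j.
have fin : finI (a * T - b * c).
  have -> : a * T - b * c = a * (T - op t1) +
      ((a * d ^+ m - op r) * op t - (b * d ^+ n - op s) * op u) * int ^+ j.
    have -> : (a * d ^+ m - op r) * op t - (b * d ^+ n - op s) * op u =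
        a * d ^+ m * op t - b * d ^+ n * op u.
      by rewrite 2!mulrBl E opprB addrA subrK.
    have -> : op t1 = d ^+ m * op t * int ^+ j.
      by rewrite -op_iter_dmul tj op_mulXn_int.
    by rewrite /c mulrBr mulrBl !mulrA addrA subrK.
  rewrite I1_valD; apply: finite_supportD.
    by rewrite I1_valM; exact: finite_supportMl.
  rewrite I1_valM; apply: finite_supportMr; rewrite I1_valB.
  by apply: finite_supportB; rewrite I1_valM; exact: finite_supportMr.
have [h [hb bh]] := bij_inverse b_bij.
have [e Ee] : exists e : I1 K, val e = h * val (a * T - b * c).
  by apply: finite_support_I1 => //; exact: finite_supportMl.
exists T, (c + e); split=> //; apply/subr0_eq/val_inj.
rewrite mulrDr opprD addrA I1_valB (I1_valM b e) Ee mulrA bh mul1r subrr.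
by rewrite rmorph0.
Qed.

Lemma I1_0_regular_right_Ore_set : regular_right_Ore_set (@I1_0 K).
Proof.
split; last by move=> a; exact: I1_0_regular.
split; last exact: I1_0_right_Ore_condition.
have I1_0E a : I1_0 a = bijective (val a : endpoly K) by [].
split=> [|a b]; rewrite !I1_0E; first by rewrite I1_val1; exists id.
by move=> a_bij b_bij; rewrite I1_valM; exact: bij_comp a_bij b_bij.
Qed.

End SkewPolynomials.

(** * The involution and the right module K[d] *)

Section Star.
Set Implicit Arguments.
Unset Strict Implicit.
Unset Printing Implicit Defensive.
Variable K : fieldType.
Implicit Types (p q c : {poly K}) (a b : I1 K) (f g : endpoly K).
Hypothesis charK : [pchar K] =i pred0.
Notation x := (I1_x K).
Notation d := (I1_d K).
Notation H := (I1_H K).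
Notation int := (I1_int K).
Notation star := (I1_star charK).
Notation Kd a := (Kd_act charK a : endpoly K).

Lemma star_linear k a b : star (k *: a + b) = k *: star a + star b.
Proof. by have [sL _ _ _ _] := I1_starP charK; rewrite sL. Qed.
Lemma starM a b : star (a * b) = star b * star a.
Proof. by have [_ _ sM _ _] := I1_starP charK. Qed.
Lemma star1 : star 1 = 1.
Proof. by have [_ s1 _ _ _] := I1_starP charK. Qed.
Lemma star_d : star d = int.
Proof. by have [_ _ _ _ [sd _ _]] := I1_starP charK. Qed.
Lemma star_int : star int = d.
Proof. by have [_ _ _ _ [_ si _]] := I1_starP charK. Qed.
Lemma star_H : star H = H.
Proof. by have [_ _ _ _ [_ _ sH]] := I1_starP charK. Qed.
Lemma starD a b : star (a + b) = star a + star b.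
Proof. by rewrite -[a]scale1r star_linear !scale1r. Qed.
Lemma starB : zmod_morphism star.
Proof. by move=> a b; rewrite addrC -scaleN1r star_linear scaleN1r addrC. Qed.
Lemma star0 : star 0 = 0.
Proof. by rewrite -{1}(subrr 0) starB subrr. Qed.

Lemma starZ k a : star (k *: a) = k *: star a.
Proof. by rewrite -[k *: a]addr0 star_linear star0 addr0. Qed.

Lemma starK : involutive star.
Proof.
elim/I1_ind => [|k u v Hu Hv|u v Hu Hv|||].
- by rewrite !star1.
- by rewrite !star_linear Hu Hv.
- by rewrite !starM Hu Hv.
- by rewrite (I1_x_int_H charK) (starM int H) star_H star_int (starM H d) star_H star_d.
- by rewrite star_d star_int.
- by rewrite star_int star_d.
Qed.

Lemma star_at_d p : star (at_d p) = horner_alg int p.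
Proof.
elim/poly_ind: p => [|p c IH]; first by rewrite at_d0 rmorph0 star0.
rewrite at_dD at_dX at_dC horner_algMXaddC starD starM star_d IH.
rewrite starZ star1; congr (_ + _).
transitivity (horner_alg int ('X * p)); first by rewrite rmorphM /= horner_algX.
by rewrite mulrC rmorphM /= horner_algX.
Qed.

Lemma size_poly_int p : p != 0 -> size (poly_int p) = (size p).+1.
Proof.
move=> p0; have sp : size p = (size p).-1.+1 by rewrite prednK // lt0n size_poly_eq0.
apply/eqP; rewrite eqn_leq; apply/andP; split.
  apply/leq_sizeP => -[//|i] pi; rewrite coef_poly_int.
  by rewrite nth_default ?mul0r // -ltnS.
rewrite ltnNge; apply/negP => /leq_sizeP/(_ (size p) (leqnn _))/eqP.
rewrite coef_poly_int sp mulf_eq0 invr_eq0 (negPf (Defs.natS_neq0 charK _)) orbF.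
by rewrite -lead_coefE lead_coef_eq0 (negPf p0).
Qed.

(** The map p(d) |-> p(int) 1, which sends d^i to x^i / i!. *)
Fact divided_power_linear : linear (fun p => (val (horner_alg int p) : endpoly K) 1).
Proof.
move=> k p q.
have -> : horner_alg int (k *: p + q) = k *: horner_alg int p + horner_alg int q.
  by rewrite linearP /= mulr_algl.
by rewrite I1_valD I1_valZ endpoly_addE endpoly_scaleE.
Qed.
Definition divided_power := Endpoly divided_power_linear.

Lemma divided_power_bij : bijective divided_power.
Proof.
apply: triangular_bij => n /=; rewrite rmorphXn /= horner_algX.
elim: n => [|n IH]; first by rewrite expr0 I1_val1 endpoly_1E size_poly1.
rewrite exprS I1_valM endpoly_mulE /= size_poly_int ?IH //.
by rewrite -size_poly_eq0 IH.
Qed.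

(** Apply star to p(d) a - q(d) = int b, where q is the image of p under a, and
evaluate at the polynomial 1, which the d on the right kills. *)
Lemma Kd_act_star a p :
  divided_power (Kd a p) = (val (star a) : endpoly K) (divided_power p).
Proof.
have [b /(congr1 (fun u => (val (star u) : endpoly K) 1))] := Kd_funP charK a p.
rewrite starB !starM star_int !star_at_d I1_valB !I1_valM.
move=> E; apply/esym/subr0_eq.
rewrite -[LHS]/(((val (star a) : endpoly K) * val (horner_alg int p) -
  val (horner_alg int (Kd a p)))%R 1) E.
by rewrite endpoly_mulE /= -polyC1 derivC linear0.
Qed.

Lemma J1_0_star : J1_0 charK = star @^-1` (@I1_0 K).
Proof.
have [dpi dpK Kdp] := divided_power_bij.
rewrite eqEsubset; split=> a /=.
- move=> a_bij; have : bijective (divided_power \o (Kd a) \o dpi).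
    by apply: bij_comp; [apply: bij_comp => //; exact: divided_power_bij|exists divided_power].
  move=> /eq_bij; apply => p.
  change (divided_power (Kd a (dpi p)) = (val (star a) : endpoly K) p).
  by rewrite Kd_act_star Kdp.
- move=> a_bij; have : bijective (dpi \o (val (star a) : endpoly K) \o divided_power).
    by apply: bij_comp; [apply: bij_comp => //; exists divided_power|exact: divided_power_bij].
  move=> /eq_bij; apply => p.
  change (dpi ((val (star a) : endpoly K) (divided_power p)) = Kd a p).
  by rewrite -Kd_act_star dpK.
Qed.

Lemma Kd_act_eq0 a : Kd_act charK a = 0 -> a = 0.
Proof.
move=> a0; apply: (inv_inj starK); rewrite star0; apply: val_inj.
apply: endpoly_eq => p; have [dpi dpK Kdp] := divided_power_bij.
by rewrite -[p]Kdp -Kd_act_star a0 rmorph0 [LHS]linear0.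
Qed.

(** * The element 1 + d and its star *)

Lemma I1_0_1d : I1_0 (1 + d).
Proof.
apply: triangular_bij => n; rewrite I1_valD I1_val1 endpoly_addE endpoly_1E /=.
by rewrite size_polyDl ?lt_size_deriv ?size_polyXn // -size_poly_eq0 size_polyXn.
Qed.

Lemma star_1d : star (1 + d) = 1 + int.
Proof. by rewrite starD star1 star_d. Qed.

Lemma not_surj_1int p : (val (1 + int) : endpoly K) p <> 1.
Proof.
rewrite I1_valD I1_val1 endpoly_addE endpoly_1E => E.
have [p0|p0] := eqVneq p 0.
  by move/eqP: E; rewrite p0 linear0 addr0 eq_sym oner_eq0.
have := congr1 (fun q : {poly K} => size q) E.
rewrite addrC /= size_polyDl size_poly_int // size_poly1 => -[/eqP].
by rewrite size_poly_eq0 (negPf p0).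
Qed.

Lemma not_I1_0_1int : ~ I1_0 (1 + int).
Proof. by move=> [g _ /(_ 1)]; exact: not_surj_1int. Qed.

Lemma J1_0_1int : J1_0 charK (1 + int).
Proof. by rewrite J1_0_star /= -star_1d starK; exact: I1_0_1d. Qed.

(** Regularity is invariant under star although bijectivity on K[x] is not;
this asymmetry is the source of all the negative statements. *)
Lemma regular_1int : regular (1 + int).
Proof.
by rewrite -star_1d; apply: (regular_sigma starB starM starK);
  apply: I1_0_regular; exact: I1_0_1d.
Qed.

(** * The largest Ore sets and their localizations *)

Lemma I1_0_largest : largest_regular_right_Ore_set (@I1_0 K).
Proof.
apply: greatest_largest_right; first exact: I1_0_regular_right_Ore_set.
by move=> T [[_ TO] TC]; exact: regular_right_Ore_I1_0.
Qed.

Lemma regular_left_Ore_J1_0 T : regular_left_Ore_set T -> T `<=` J1_0 charK.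
Proof.
move=> /(regular_left_Ore_set_sigma starB starM starK)[[_ TO] TC] a Ta.
rewrite J1_0_star; apply: (regular_right_Ore_I1_0 charK TC TO).
by rewrite /= starK.
Qed.

Lemma J1_0_largest : largest_regular_left_Ore_set (J1_0 charK).
Proof.
apply: greatest_largest_left; last exact: regular_left_Ore_J1_0.
rewrite J1_0_star; apply: (regular_right_Ore_set_sigma starB starM starK).
exact: I1_0_regular_right_Ore_set.
Qed.

Lemma largest_right_I1_0 S : largest_regular_right_Ore_set S -> S = @I1_0 K.
Proof. by move=> [_ uniqS]; apply/esym/uniqS; case: I1_0_largest. Qed.

Lemma largest_left_J1_0 S : largest_regular_left_Ore_set S -> S = J1_0 charK.
Proof. by move=> [_ uniqS]; apply/esym/uniqS; case: J1_0_largest. Qed.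

(** As I_1^0 is a right Ore set, the right fractions form a subalgebra; it
contains the generators, hence is the whole algebra. *)
Lemma It_localization :
  right_localization (@I1_0 K) (@I1_It K : {rmorphism I1 K -> It K}).
Proof.
have inv (s : I1 K) : I1_0 s -> exists u, inverse_of u (I1_It s).
  move=> Ss; have [g [gs sg]] := bij_inverse Ss.
  have gG : g \in gen_alg (@It_gens K) by apply: mem_gen_alg; right; exists s.
  by exists (Subalg gG); split; apply: val_inj;
    rewrite [LHS]rmorphM [RHS]rmorph1.
split=> [//|q|r].
  have oreS := (I1_0_regular_right_Ore_set charK).1.
  pose iota a : endpoly K := val a.
  have iotaB : zmod_morphism iota by exact: I1_valB.
  have iotaM : monoid_morphism iota by split; [exact: I1_val1|exact: I1_valM].
  have /(_ _ (valP q)) : forall e, e \in gen_alg (@It_gens K) ->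
      right_fraction iota (@I1_0 K) e.
    apply: gen_alg_sub.
    - by rewrite -iotaM.1; exact: right_fraction_img.
    - move=> k u v Fu Fv; rewrite -mulr_algl; apply: right_fraction_scale => //.
      by exists k%:A; rewrite /iota I1_valZ I1_val1.
    - by move=> u v; exact: right_fractionM.
    - move=> g [[a ->]|[s Ss [gs _]]]; first exact: right_fraction_img.
      exact: right_fraction_inv gs.
  move=> [s [r [Ss qs]]]; have [u [us su]] := inv s Ss.
  exists r, s, u; split=> //.
  have E : q * I1_It s = I1_It r by apply: val_inj; rewrite rmorphM.
  by change (q = I1_It r * u); rewrite -E -mulrA su mulr1.
split=> [r0|[s Ss rs]].
  exists 1; first exact: (I1_0_regular_right_Ore_set charK).1.1.1.
  by rewrite mulr1; apply: val_inj; have := congr1 val r0; rewrite !rmorph0.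
by rewrite ((I1_0_regular Ss).2 _ rs) rmorph0.
Qed.

Lemma J1_0_regular s : J1_0 charK s -> regular s.
Proof. exact: J1_0_largest.1.1.2. Qed.

(** The composite of star with the action on K[d] is a ring morphism into the
endomorphisms of K[d] which inverts I_1^0.  Its right fractions are the left
fractions sought, multiplication being reversed. *)
Lemma Jt_localization : left_localization (J1_0 charK)
  (@I1_Jt K charK : {rmorphism I1 K -> Jt charK}).
Proof.
have inv s : J1_0 charK s -> exists u, inverse_of u (I1_Jt charK s).
  move=> Ss; have [g [gs sg]] := bij_inverse Ss.
  have gG : (g : (endpoly K)^c) \in gen_alg (Jt_gens charK).
    by apply: mem_gen_alg; right; exists s.
  by exists (Subalg gG); split; apply: val_inj;
    rewrite [LHS]rmorphM [RHS]rmorph1.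
split=> [//|q|r].
  have oreS := (I1_0_regular_right_Ore_set charK).1.
  pose iota a : endpoly K := Kd_act charK (star a).
  have iotaB : zmod_morphism iota.
    by move=> a b; rewrite /iota starB; exact: (rmorphB (Kd_act charK)).
  have iotaM : monoid_morphism iota.
    split=> [|a b]; rewrite /iota; first by rewrite star1; exact: (rmorph1 (Kd_act charK)).
    by rewrite starM; exact: (rmorphM (Kd_act charK)).
  have /(_ _ (valP q)) : forall e, e \in gen_alg (Jt_gens charK) ->
      right_fraction iota (@I1_0 K) e.
    apply: gen_alg_sub.
    - have -> : (1 : (endpoly K)^c) = iota 1 by rewrite iotaM.1.
      exact: right_fraction_img.
    - move=> k u v Fu Fv; have -> : k *: u = (k *: 1 : endpoly K) * (u : endpoly K).
        by rewrite mulr_algl.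
      apply: right_fraction_scale => //.
      exists k%:A; rewrite /iota starZ star1.
      by rewrite linearZ (rmorph1 (Kd_act charK)).
    - by move=> u v Fu Fv; exact: (right_fractionM iotaM oreS Fv Fu).
    - move=> g [[a ->]|[s Ss [gs sg]]].
        by rewrite -[a]starK; exact: right_fraction_img.
      rewrite J1_0_star in Ss; apply: (right_fraction_inv iotaM (Ss : I1_0 (star s))).
      by rewrite /iota starK; exact: sg.
  move=> [s [r [Ss qs]]]; have Js : J1_0 charK (star s).
    by rewrite J1_0_star /= starK.
  have [u [us su]] := inv _ Js.
  exists (star r), (star s), u; split=> //.
  have E : I1_Jt charK (star s) * q = I1_Jt charK (star r).
    by apply: val_inj; rewrite rmorphM.
  by change (q = u * I1_Jt charK (star r)); rewrite -E mulrA us mul1r.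
split=> [r0|[s Ss rs]].
  exists 1; first exact: J1_0_largest.1.1.1.1.1.
  by rewrite mul1r; apply: Kd_act_eq0; have := congr1 val r0; rewrite rmorph0.
by rewrite ((J1_0_regular Ss).1 _ rs) rmorph0.
Qed.

Lemma regular_not_right_Ore : ~ right_Ore_condition (@regular_elements (I1 K)).
Proof.
move=> CO; apply: not_I1_0_1int.
by apply: (regular_right_Ore_I1_0 charK _ CO) => //; exact: regular_1int.
Qed.

Lemma regular_not_left_Ore : ~ left_Ore_condition (@regular_elements (I1 K)).
Proof.
move=> /(left_Ore_condition_sigma starM starK) CO; apply: not_I1_0_1int.
apply: (regular_right_Ore_I1_0 charK _ CO).
  exact: (regular_sub_sigma starB starM starK).
by apply: (regular_sigma starB starM starK); exact: regular_1int.
Qed.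

(** Under such an isomorphism 1 + d would be invertible in the left localization,
so s = r (1 + d) for some s in J_1^0.  The star of s is surjective and factors
through 1 + int, which is not surjective. *)
Lemma Frac_not_isomorphic (Qr Ql : pzRingType)
    (fr : {rmorphism I1 K -> Qr}) (fl : {rmorphism I1 K -> Ql}) :
  is_Frac_r fr -> is_Frac_l fl -> ~ R_isomorphic fr fl.
Proof.
move=> [S /largest_right_I1_0 -> [invr _ _]].
move=> [T /largest_left_J1_0 -> [invl fracl kerl]] [phi [_ phi_f]].
have [u [us _]] := invr _ I1_0_1d.
have [r [s [v [Js [vs sv] E]]]] := fracl (phi u).
have sE : s = r * (1 + d).
  apply/subr0_eq; have /kerl[t Jt] : fl (s - r * (1 + d)) = 0.
    apply/eqP; rewrite rmorphB rmorphM subr_eq0; apply/eqP.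
    have pu : phi u * fl (1 + d) = 1 by rewrite -phi_f -rmorphM us rmorph1.
    have pr : fl s * phi u = fl r by rewrite E mulrA sv mul1r.
    by rewrite -pr -mulrA pu mulr1.
  exact: (J1_0_regular Jt).1.
have : J1_0 charK s by [].
rewrite J1_0_star /= sE starM => -[g fK gK].
by have := gK 1; rewrite I1_valM endpoly_mulE star_1d; exact: not_surj_1int.
Qed.

(** Precomposed with star, a left localization at J_1^0 becomes a right
localization at I_1^0 into the converse ring. *)
Lemma Frac_anti_isomorphic (Qr Ql : pzRingType)
    (fr : {rmorphism I1 K -> Qr}) (fl : {rmorphism I1 K -> Ql}) :
  is_Frac_r fr -> is_Frac_l fl -> R_anti_isomorphic fr fl.
Proof.
move=> [S /largest_right_I1_0 -> locr] [T /largest_left_J1_0 -> locl].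
have loc := left_localization_sigma starB starM starK locl.
have SE : star @^-1` J1_0 charK = @I1_0 K.
  by rewrite J1_0_star eqEsubset; split=> a /=; rewrite starK.
rewrite SE in loc.
have [phi [phi_bij phi_f]] :=
  right_localization_unique (I1_0_regular_right_Ore_set charK).1 locr loc.
exists phi; split=> //; rewrite eqEsubset; split=> q.
- by move=> [_ [r _ <-] <-]; rewrite phi_f; exists (star r).
- by move=> [r _ <-]; exists (fr (star r)); [exists (star r)|rewrite phi_f /= /twist starK].
Qed.

End Star.

(** * Quotient rings of I_1 *)

Theorem theorem9p7 (K : fieldType) (charK : [pchar K] =i pred0) :
  [/\ ~ left_Ore_condition (@regular_elements (I1 K)),
      ~ right_Ore_condition (@regular_elements (I1 K)),
      ~ (exists (Q : pzRingType) (f : {rmorphism I1 K -> Q}),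
           left_quotient_ring f) &
      ~ (exists (Q : pzRingType) (f : {rmorphism I1 K -> Q}),
           right_quotient_ring f)] /\
  (largest_regular_right_Ore_set (@I1_0 K) /\
   right_localization (@I1_0 K) (@I1_It K : {rmorphism I1 K -> It K})) /\
  [/\ J1_0 charK = I1_star charK @` (@I1_0 K),
      largest_regular_left_Ore_set (J1_0 charK) &
      left_localization (J1_0 charK)
        (@I1_Jt K charK : {rmorphism I1 K -> Jt charK})] /\
  [/\ forall (Qr : pzRingType) (fr : {rmorphism I1 K -> Qr})
             (Ql : pzRingType) (fl : {rmorphism I1 K -> Ql}),
        is_Frac_r fr -> is_Frac_l fl ->
        ~ R_isomorphic fr fl /\ R_anti_isomorphic fr fl,
      forall S : set (I1 K),
        largest_regular_right_Ore_set S -> ~ left_Ore_set S &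
      forall S : set (I1 K),
        largest_regular_left_Ore_set S -> ~ right_Ore_set S].
Proof.
have stK := starK charK.
split; first split.
- exact: regular_not_left_Ore.
- exact: regular_not_right_Ore.
- by move=> [Q [f /left_quotient_Ore]]; exact: regular_not_left_Ore.
- by move=> [Q [f /right_quotient_Ore]]; exact: regular_not_right_Ore.
split; first by split; [exact: I1_0_largest|exact: It_localization].
split; split.
- rewrite J1_0_star eqEsubset; split=> a.
    by move=> Sa; exists (I1_star charK a); rewrite ?stK.
  by move=> [b Sb <-]; rewrite /= stK.
- exact: J1_0_largest.
- exact: Jt_localization.
- move=> Qr fr Ql fl Fr Fl; split; last exact: Frac_anti_isomorphic.
  exact: Frac_not_isomorphic.
- move=> S /(largest_right_I1_0 charK) -> SO.
  have : J1_0 charK (1 + I1_d K).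
    have SL : regular_left_Ore_set (@I1_0 K).
      by split=> // a; exact: I1_0_regular.
    exact: (regular_left_Ore_J1_0 charK SL (I1_0_1d K)).
  by rewrite J1_0_star /= star_1d; exact: not_I1_0_1int.
- move=> S /(largest_left_J1_0 charK) -> SO.
  apply: (not_I1_0_1int charK).
  apply: (regular_right_Ore_I1_0 charK _ SO.2 (J1_0_1int charK)) => a.
  exact: J1_0_regular.
Qed.
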